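(* Let $k\ge2$ and $\Gamma=\Gamma(2^k)$. Let $F$ be a rational boundary component of $\mathfrak h_n$ and $\gamma\in\Gamma(2^k)$ with $F^\gamma\neq\emptyset$. Then there exists $\gamma_1\in\Gamma(2^k)$ such that $F^\gamma=F^{\gamma_1}$ and $F^{\gamma_1}$ is contained in the closure $\overline{\mathfrak h_n^{\gamma_1}}$ in the Satake partial compactification $\overline{\mathfrak h}_n$.
   Context: $\mathbf{Sp}(2n,\mathbb R)$: real matrices $g=\begin{pmatrix}A&B\\C&D\end{pmatrix}$ with ${}^tgJg=J$, $J=\begin{pmatrix}0&I\\-I&0\end{pmatrix}$, acting on $\mathfrak h_n=\{Z\in M_n(\mathbb C):{}^tZ=Z,\mathrm{Im}Z>0\}$ by $gZ=(AZ+B)(CZ+D)^{-1}$. $\tau\begin{pmatrix}A&B\\C&D\end{pmatrix}=\begin{pmatrix}A&-B\\-C&D\end{pmatrix}$ and $\tau(Z)=-\overline Z$; $\mathfrak h_n^\gamma=\{Z:\gamma Z=\tau(Z)\}$. $\Gamma(N)=\{\gamma\in\mathbf{Sp}(2n,\mathbb Z):\gamma\equiv I\bmod N\}$. $\overline{\mathfrak h}_n$ is the Satake partial compactification (all rational boundary components attached, Satake topology), on which $\mathbf{Sp}(2n,\mathbb Q)$ acts and to which $\tau$ extends with $\tau(gx)=\tau(g)\tau(x)$. For $0\le q<n$ the standard boundary component $F_q$ is the image of $\mathfrak h_q$ ($\mathfrak h_0$ a point) under $Z\mapsto\lim_Y\begin{pmatrix}Z&0\\0&iY\end{pmatrix}$,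 the limit as the positive definite $(n-q)\times(n-q)$ matrix $Y$ goes to infinity; a rational boundary component of rank $q$ is a set $gF_q$ with $g\in\mathbf{Sp}(2n,\mathbb Q)$. For a boundary component $F$, $F^\gamma=\{x\in F:\tau(x)=\gamma x\}$. *)

(* Defs.v *)
From mathcomp Require Import all_boot all_order all_algebra.
From mathcomp Require Import complex.
From mathcomp Require Import Rstruct.
From Stdlib Require Import Reals.
Set Implicit Arguments. Unset Strict Implicit. Unset Printing Implicit Defensive.
Import Order.TTheory GRing.Theory Num.Theory.
Local Open Scope ring_scope.

Notation RR := Rdefinitions.R.
Notation CC := (Rdefinitions.R[i]).

Definition ent {T : nmodType} {m p : nat} (A : 'M[T]_(m, p)) (i j : nat) : T :=
  match (insub i : option 'I_m), (insub j : option 'I_p) with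
  | Some i', Some j' => A i' j'
  | _, _ => 0
  end.

Definition Jmx (n : nat) : 'M[rat]_(n + n) := block_mx 0 1%:M (- 1%:M) 0.

Definition SpQ (n : nat) (g : 'M[rat]_(n + n)) : Prop :=
  g^T *m Jmx n *m g = Jmx n.

Definition integral_mx {m p : nat} (g : 'M[rat]_(m, p)) : Prop :=
  forall i j, g i j \is a Num.int.

Definition SpZ (n : nat) (g : 'M[rat]_(n + n)) : Prop := SpQ g /\ integral_mx g.

Definition GammaN (n N : nat) (g : 'M[rat]_(n + n)) : Prop :=
  SpZ g /\ forall i j, ((g i j - (i == j)%:R) / N%:R) \is a Num.int.

Definition cmx {m p : nat} (g : 'M[rat]_(m, p)) : 'M[CC]_(m, p) := map_mx ratr g.

Definition Im_mx {m p : nat} (Z : 'M[CC]_(m, p)) : 'M[RR]_(m, p) :=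
  map_mx (@complex.Im RR) Z.

Definition posdef {m : nat} (Y : 'M[RR]_m) : Prop :=
  forall v : 'cV[RR]_m, v != 0 -> 0 < (v^T *m Y *m v) 0 0.

Definition hn (n : nat) (Z : 'M[CC]_n) : Prop := Z^T = Z /\ posdef (Im_mx Z).

Definition mact (n : nat) (g : 'M[rat]_(n + n)) (Z : 'M[CC]_n) : 'M[CC]_n :=
  (cmx (ulsubmx g) *m Z + cmx (ursubmx g))
    *m invmx (cmx (dlsubmx g) *m Z + cmx (drsubmx g)).

Definition tauZ (n : nat) (Z : 'M[CC]_n) : 'M[CC]_n := - map_mx conjc Z.

Definition hn_fix (n : nat) (gam : 'M[rat]_(n + n)) (Z : 'M[CC]_n) : Prop :=
  hn Z /\ mact gam Z = tauZ Z.

(* The Satake partial compactification, as a set.                      *)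
(* A point is modelled by a complex subspace of C^{2n} (a predicate on  *)
(* column vectors, compared extensionally).  Z in h_n corresponds to the *)
(* column span of [Z; I]; the point of F_q obtained from z in h_q as the *)
(* limit lim_Y [[z,0],[0,iY]] is the span of the columns of [z;0;I;0]   *)
(* together with e_{q+1},...,e_n, i.e. the limit of the spans.           *)
Definition pt (n : nat) := 'cV[CC]_(n + n) -> Prop.

Definition pt_eq (n : nat) (x y : pt n) : Prop := forall v, x v <-> y v.

(* W_q(z), for z : 'M_q with q <= n.  For q = n this is the image of z in h_n. *)
Definition Wq (n q : nat) (z : 'M[CC]_q) : pt n :=
  fun v => exists (a : 'cV[CC]_q) (b : 'cV[CC]_(n - q)),
    forall i : 'I_(n + n),
      v i 0 = (let k := nat_of_ord i in
               if (k < q)%nat then ent (z *m a) k 0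
               else if (k < n)%nat then ent b (subn k q) 0
               else if (k < n + q)%nat then ent a (subn k n) 0
               else 0).

Definition gact (n : nat) (g : 'M[rat]_(n + n)) (x : pt n) : pt n :=
  fun v => exists w, x w /\ v = cmx g *m w.

(* extension of tau: tau(x) = { E conj(w) : w in x }, E = diag(I,-I) *)
Definition Emx (n : nat) : 'M[CC]_(n + n) := block_mx 1%:M 0 0 (- 1%:M).

Definition tau_pt (n : nat) (x : pt n) : pt n :=
  fun v => x (map_mx conjc (Emx n *m v)).

Definition bcomp (n q : nat) (g : 'M[rat]_(n + n)) (x : pt n) : Prop :=
  exists z : 'M[CC]_q, hn z /\ pt_eq x (gact g (@Wq n q z)).

Definition bcomp_fix (n q : nat) (g gam : 'M[rat]_(n + n)) (x : pt n) : Prop :=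
  bcomp q g x /\ pt_eq (tau_pt x) (gact gam x).

Definition blk11 (n q : nat) (Z : 'M[CC]_n) : 'M[CC]_q :=
  \matrix_(i < q, j < q) ent Z i j.

Definition schurY (n q : nat) (Z : 'M[CC]_n) : 'M[RR]_(n - q) :=
  let Y := Im_mx Z in
  let Y11 : 'M[RR]_q := \matrix_(i < q, j < q) ent Y i j in
  let Y12 : 'M[RR]_(q, n - q) := \matrix_(i < q, j < n - q) ent Y i (q + j) in
  let Y21 : 'M[RR]_(n - q, q) := \matrix_(i < n - q, j < q) ent Y (q + i) j in
  let Y22 : 'M[RR]_(n - q) := \matrix_(i < n - q, j < n - q) ent Y (q + i) (q + j) in
  Y22 - Y21 *m invmx Y11 *m Y12.

Definition close_mx {m : nat} (A B : 'M[CC]_m) (eps : RR) : Prop :=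
  forall i j, `|complex.Re (A i j - B i j)| < eps /\
              `|complex.Im (A i j - B i j)| < eps.

(* Basic Satake neighbourhood (its trace on h_n) of the point g.W_q(z):
   the union over delta in the subgroup of g^-1 Sp(2n,Z) g fixing F_q
   pointwise of  g delta { Z in h_n : |Z1 - z| < eps, Schur(Im Z) > c I }. *)
Definition satake_nbhd (n q : nat) (g : 'M[rat]_(n + n)) (z : 'M[CC]_q)
    (eps c : RR) (Z' : 'M[CC]_n) : Prop :=
  exists (delta : 'M[rat]_(n + n)) (Z : 'M[CC]_n),
    SpQ delta /\ SpZ (g *m delta *m invmx g) /\
    (forall w : 'M[CC]_q, hn w -> pt_eq (gact delta (@Wq n q w)) (@Wq n q w)) /\
    hn Z /\ close_mx (blk11 q Z) z eps /\ posdef (schurY q Z - c%:M) /\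
    Z' = mact (g *m delta) Z.

Definition satake_closure (n : nat) (S : 'M[CC]_n -> Prop) (x : pt n) : Prop :=
  (exists Z0 : 'M[CC]_n, hn Z0 /\ pt_eq x (@Wq n n Z0) /\
     forall eps : RR, 0 < eps -> exists Z, S Z /\ close_mx Z Z0 eps)
  \/
  ((exists (q : nat) (g : 'M[rat]_(n + n)), (q < n)%nat /\ SpQ g /\ bcomp q g x) /\
   forall (q : nat) (g : 'M[rat]_(n + n)) (z : 'M[CC]_q),
     (q < n)%nat -> SpQ g -> hn z -> pt_eq x (gact g (@Wq n q z)) ->
     forall eps c : RR, 0 < eps -> 0 < c ->
       exists Z', S Z' /\ satake_nbhd g z eps c Z').

(* Main.v *)
Require Import Defs.
From mathcomp Require Import all_boot all_order all_algebra.
From mathcomp Require Import complex.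
From mathcomp Require Import Rstruct.
From mathcomp Require Import ring lra zify.
Set Implicit Arguments. Unset Strict Implicit. Unset Printing Implicit Defensive.
Import Order.TTheory GRing.Theory Num.Theory.
Local Open Scope ring_scope.

(* With [E = diag(1, -1)], a point [x], seen as a subspace of [C^(2n)], satisfies
   [tau x = gam x] iff the antisymplectic integral matrix [sg = E gam] exchanges [x]
   and its conjugate.  If [x] lies on [F], then [sg] preserves the isotropic rational
   subspace [U] attached to [F], and [F^gam] depends only on the map [sg_S] induced
   on [U^perp / U].  This map is congruent to 1 modulo 2 and preserves a positive
   definite form, so [sg_S^2], congruent to 1 modulo 4, is 1.  In an integral
   symplectic basis adapted to [U] one replaces the action of [sg] on [U] by a
   congruent involution (idempotents modulo [2 ^ (k - 1)] lift to integral ones);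
   the square of the result is unipotent, and dividing by its square root yields an
   antisymplectic integral involution [sg1 = E gam1], congruent to [sg] modulo [2 ^ k]
   and with the same [sg_S].
   Over the rationals an involution [sg1] preserving [U] is conjugate, under the
   unipotent radical of the stabiliser of [F], to its Levi part, which fixes
   [diag(z, i t (1 + s s^T))] for every [t > 0] when [z] is fixed by [sg_S] and [s] is
   the action on [U]; letting [t] grow shows that [F^gam1] lies in the closure. *)

(** * Integral matrices and congruences *)

Section IntegralMatrices.

Lemma integral_mx0 m p : integral_mx (0 : 'M[rat]_(m, p)).
Proof. by move=> i j; rewrite mxE rpred0. Qed.

Lemma integral_mx1 m : integral_mx (1%:M : 'M[rat]_m).
Proof. by move=> i j; rewrite mxE rpredMn ?rpred1. Qed.

Lemma integral_mxD m p (A B : 'M[rat]_(m, p)) :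
  integral_mx A -> integral_mx B -> integral_mx (A + B).
Proof. by move=> hA hB i j; rewrite mxE rpredD. Qed.

Lemma integral_mxN m p (A : 'M[rat]_(m, p)) : integral_mx A -> integral_mx (- A).
Proof. by move=> hA i j; rewrite mxE rpredN. Qed.

Lemma integral_mxB m p (A B : 'M[rat]_(m, p)) :
  integral_mx A -> integral_mx B -> integral_mx (A - B).
Proof. by move=> hA hB; apply: integral_mxD => //; apply: integral_mxN. Qed.

Lemma integral_mxM m p r (A : 'M[rat]_(m, p)) (B : 'M[rat]_(p, r)) :
  integral_mx A -> integral_mx B -> integral_mx (A *m B).
Proof. by move=> hA hB i j; rewrite mxE rpred_sum // => l _; rewrite rpredM. Qed.

Lemma integral_mxZ m p c (A : 'M[rat]_(m, p)) :
  c \is a Num.int -> integral_mx A -> integral_mx (c *: A).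
Proof. by move=> hc hA i j; rewrite mxE rpredM. Qed.

Lemma integral_mx_tr m p (A : 'M[rat]_(m, p)) : integral_mx A -> integral_mx A^T.
Proof. by move=> hA i j; rewrite mxE. Qed.

Lemma integral_col_mx m1 m2 p (A : 'M[rat]_(m1, p)) (B : 'M[rat]_(m2, p)) :
  integral_mx A -> integral_mx B -> integral_mx (col_mx A B).
Proof. by move=> hA hB i j; rewrite mxE; case: split. Qed.

Lemma integral_row_mx m p1 p2 (A : 'M[rat]_(m, p1)) (B : 'M[rat]_(m, p2)) :
  integral_mx A -> integral_mx B -> integral_mx (row_mx A B).
Proof. by move=> hA hB i j; rewrite mxE; case: split. Qed.

Lemma integral_block_mx m1 m2 p1 p2 (A : 'M[rat]_(m1, p1)) (B : 'M[rat]_(m1, p2))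
    (C : 'M[rat]_(m2, p1)) (D : 'M[rat]_(m2, p2)) :
  integral_mx A -> integral_mx B -> integral_mx C -> integral_mx D ->
  integral_mx (block_mx A B C D).
Proof. by move=> *; apply: integral_col_mx; apply: integral_row_mx. Qed.

Lemma integral_mx_intr m p (A : 'M[int]_(m, p)) : integral_mx (map_mx intr A).
Proof. by move=> i j; rewrite mxE intr_int. Qed.

Lemma integral_mxP m p (A : 'M[rat]_(m, p)) :
  integral_mx A -> exists B : 'M[int]_(m, p), A = map_mx intr B.
Proof.
move=> hA; exists (map_mx numq A); apply/matrixP=> i j.
by rewrite !mxE numqK.
Qed.

(** Formulated for rational matrices, so that a congruence can also transfer integrality from one
    side to the other. *)
Definition congr_mx (N : nat) m p (A B : 'M[rat]_(m, p)) : Prop :=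
  exists2 C, integral_mx C & A - B = N%:R *: C.

Lemma congr_mx_refl N m p (A : 'M[rat]_(m, p)) : congr_mx N A A.
Proof. by exists 0; [exact: integral_mx0 | rewrite subrr scaler0]. Qed.

Lemma congr_mx_sym N m p (A B : 'M[rat]_(m, p)) : congr_mx N A B -> congr_mx N B A.
Proof.
case=> C hC e; exists (- C); first exact: integral_mxN.
by rewrite -opprB e scalerN.
Qed.

Lemma congr_mx_trans N m p (A B C : 'M[rat]_(m, p)) :
  congr_mx N A B -> congr_mx N B C -> congr_mx N A C.
Proof.
case=> X hX eX [Y hY eY]; exists (X + Y); first exact: integral_mxD.
by rewrite scalerDr -eX -eY addrA subrK.
Qed.

Lemma congr_mxD N m p (A B C D : 'M[rat]_(m, p)) :
  congr_mx N A B -> congr_mx N C D -> congr_mx N (A + C) (B + D).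
Proof.
move=> [X hX eX] [Y hY eY]; exists (X + Y); first exact: integral_mxD.
by rewrite scalerDr -eX -eY opprD addrACA.
Qed.

Lemma congr_mxMl N m p r (L : 'M[rat]_(m, p)) (A B : 'M[rat]_(p, r)) :
  integral_mx L -> congr_mx N A B -> congr_mx N (L *m A) (L *m B).
Proof.
move=> hL [X hX eX]; exists (L *m X); first exact: integral_mxM.
by rewrite -mulmxBr eX scalemxAr.
Qed.

Lemma congr_mxMr N m p r (A B : 'M[rat]_(m, p)) (L : 'M[rat]_(p, r)) :
  integral_mx L -> congr_mx N A B -> congr_mx N (A *m L) (B *m L).
Proof.
move=> hL [X hX eX]; exists (X *m L); first exact: integral_mxM.
by rewrite -mulmxBl eX scalemxAl.
Qed.

Lemma congr_mx_integral N m p (A B : 'M[rat]_(m, p)) :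
  congr_mx N A B -> integral_mx B -> integral_mx A.
Proof.
case=> C hC e hB; rewrite -[A](subrK B) e.
by apply: integral_mxD => //; apply: integral_mxZ => //; rewrite rpred_nat.
Qed.

Lemma congr_mx_tr N m p (A B : 'M[rat]_(m, p)) :
  congr_mx N A B -> congr_mx N A^T B^T.
Proof.
case=> C hC e; exists C^T; first exact: integral_mx_tr.
by rewrite -linearB e linearZ.
Qed.

Lemma congr_mxP N m p (A B : 'M[rat]_(m, p)) : (0 < N)%N ->
  congr_mx N A B <-> forall i j, (A i j - B i j) / N%:R \is a Num.int.
Proof.
move=> N0; have hN : (N%:R : rat) != 0 by rewrite pnatr_eq0 -lt0n.
split=> [[C hC e] i j|h].
  by move/matrixP/(_ i j): e; rewrite !mxE => ->; rewrite mulrC mulKf.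
exists (N%:R^-1 *: (A - B)).
  by move=> i j; rewrite !mxE mulrC.
by rewrite scalerA divff // scale1r.
Qed.

Lemma map_mx_intr_inj m p :
  injective (map_mx intr : 'M[int]_(m, p) -> 'M[rat]_(m, p)).
Proof.
move=> A B /matrixP e; apply/matrixP=> i j; apply: (@intr_inj rat).
by have := e i j; rewrite !mxE.
Qed.

(* With [A = L D R] in Smith form and [X = R L], the hypothesis says [D X D = D]
   modulo [2 ^ k]; an even diagonal entry [d] satisfies [d (1 - x d) = 0], hence
   vanishes modulo [2 ^ k], so [L^-1 A L = D X] is congruent to a matrix of the
   shape [[1, y], [0, 0]] in the splitting odd / even. *)
Lemma int_idempotent_lift k m (A : 'M[int]_m) :
  (forall i j, ((2 ^+ k : int) %| (A *m A - A) i j)%Z) ->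
  exists2 B : 'M[int]_m, B *m B = B & forall i j, ((2 ^+ k : int) %| (B - A) i j)%Z.
Proof.
move=> hA.
have dvdM (M : 'M[int]_m) (L R : 'M[int]_m) :
    (forall i j, ((2 ^+ k : int) %| M i j)%Z) ->
    forall i j, ((2 ^+ k : int) %| (L *m M *m R) i j)%Z.
  move=> hM i j; rewrite mxE rpred_sum // => l _; rewrite dvdz_mulr //.
  by rewrite mxE rpred_sum // => l' _; rewrite dvdz_mull.
have [L uL [R uR [d _ eA]]] := int_Smith_normal_form A.
have eD : (\matrix_(i < m, j < m) (d`_i *+ (i == j :> nat))) = diag_mx (\row_(i < m) d`_i).
  by apply/matrixP=> i j; rewrite !mxE.
set D := diag_mx _ in eD; rewrite {}eD in eA.
have [X eX] : exists X, X = R *m L by exists (R *m L).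
have hX (i j : 'I_m) : ((2 ^+ k : int) %| d`_i * X i j * d`_j - d`_i *+ (i == j))%Z.
  have := dvdM _ (invmx L) (invmx R) hA i j.
  have -> : invmx L *m (A *m A - A) *m invmx R = D *m X *m D - D.
    rewrite mulmxBr mulmxBl eA !mulmxA mulVmx // mul1mx mulmxK //.
    by rewrite eX -!mulmxA mulmxV // mulmx1.
  by rewrite /D mxE mul_diag_mx mul_mx_diag !mxE.
have odd_coprime (x : int) : odd `|x| -> coprimez (2 ^+ k) x.
  move=> hx; rewrite /coprimez gcdzC; apply: coprimezXr.
  by rewrite coprimezE coprimen2.
have hev (i : 'I_m) : ~~ odd `|d`_i| -> ((2 ^+ k : int) %| d`_i)%Z.
  move=> hi; have := hX i i; rewrite eqxx mulr1n.
  have -> : d`_i * X i i * d`_i - d`_i = (d`_i * X i i - 1) * d`_i by ring.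
  rewrite Gauss_dvdzr //; apply: odd_coprime.
  move: hi; move: (d`_i) (X i i) => a b ha.
  have [c ->] : exists c : int, a = 2 * c by exists (a %/ 2)%Z; lia.
  by rewrite -mulrA; move: (c * b) => e; lia.
have hod (i j : 'I_m) : odd `|d`_j| -> ((2 ^+ k : int) %| d`_i * X i j - (i == j)%:R)%Z.
  move=> hj; have := hX i j.
  have -> : d`_i * X i j * d`_j - d`_i *+ (i == j)
            = d`_j * (d`_i * X i j - (i == j)%:R).
    by case: eqP => [->|_]; rewrite ?mulr1n ?mulr0n; ring.
  by rewrite Gauss_dvdzr // odd_coprime.
pose T : 'M[int]_m := \matrix_(i, j)
  if odd `|d`_i| then if odd `|d`_j| then (i == j)%:R else d`_i * X i j else 0.
have TT : T *m T = T.
  apply/matrixP=> i j; rewrite mxE.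
  case hi: (odd `|d`_i|); last first.
    by rewrite [RHS]mxE hi big1 // => l _; rewrite mxE hi mul0r.
  rewrite (bigD1 i) //= big1 => [|l nli].
    by rewrite addr0 [X in X * _]mxE hi eqxx mul1r.
  case hl: (odd `|d`_l|); last by rewrite [X in _ * X]mxE hl mulr0.
  by rewrite [X in X * _]mxE hi hl eq_sym (negPf nli) mul0r.
exists (L *m T *m invmx L).
  by rewrite -!mulmxA (mulmxA (invmx L)) mulVmx // mul1mx (mulmxA T) TT.
have -> : L *m T *m invmx L - A = L *m (T - D *m X) *m invmx L.
  rewrite mulmxBr mulmxBl eA; congr (_ - _).
  by rewrite eX !mulmxA mulmxK.
apply: dvdM => i j; rewrite mul_diag_mx !mxE.
case: ifPn => [hi|/hev hi]; last by rewrite sub0r rpredN dvdz_mulr.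
by case: ifPn => hj; rewrite ?subrr // -rpredN opprB hod.
Qed.

Lemma idempotent_lift k m (a : 'M[rat]_m) : integral_mx a ->
  congr_mx (2 ^ k) (a *m a) a ->
  exists2 b, b *m b = b & integral_mx b /\ congr_mx (2 ^ k) b a.
Proof.
move=> /integral_mxP[A ->] [C /integral_mxP[C' ->] eC].
have /(_ _)[|B BB hB] := @int_idempotent_lift k m A.
  move=> i j; have -> : A *m A - A = 2 ^+ k *: C'.
    apply: map_mx_intr_inj; rewrite map_mxB map_mxM eC.
    by rewrite map_mxZ /= rmorphXn natrX.
  by rewrite mxE dvdz_mulr.
exists (map_mx intr B); first by rewrite -map_mxM BB.
split; first exact: integral_mx_intr.
apply/congr_mxP; first by rewrite expn_gt0.
move=> i j; rewrite !mxE -rmorphB natrX -[2%:R]/(2%:~R) -rmorphXn.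
by apply: Qint_dvdz; have := hB i j; rewrite !mxE.
Qed.

End IntegralMatrices.

(** * Similitudes and unipotent square roots *)

Section Similitudes.
Variable n : nat.
Local Notation J := (Jmx n).
Implicit Types A B : 'M[rat]_(n + n).

Lemma JmxK : J *m J = - 1%:M.
Proof.
rewrite /Jmx mulmx_block !mulmx0 !mul0mx !mulmxN !mulNmx !mul1mx.
by rewrite !addr0 !add0r scalar_mx_block opp_block_mx oppr0.
Qed.

Lemma Jmx_tr : J^T = - J.
Proof. by rewrite /Jmx tr_block_mx opp_block_mx !trmx0 linearN /= trmx1 oppr0 opprK. Qed.

(** Symplectic similitudes of multiplier [e]; for [e = - 1] these are the antisymplectic matrices,
    such as [E gam]. *)
Definition sim (e : rat) A : Prop := A^T *m J *m A = e *: J.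

Lemma SpQ_sim A : SpQ A <-> sim 1 A.
Proof. by rewrite /sim scale1r. Qed.

Lemma sim1 : sim 1 1%:M.
Proof. by rewrite /sim trmx1 mulmx1 mul1mx scale1r. Qed.

Lemma simM e f A B : sim e A -> sim f B -> sim (e * f) (A *m B).
Proof.
rewrite /sim => hA hB; rewrite trmx_mul.
have -> : B^T *m A^T *m J *m (A *m B) = B^T *m (A^T *m J *m A) *m B by rewrite !mulmxA.
by rewrite hA -scalemxAr -scalemxAl hB scalerA.
Qed.

(** The adjoint [J^-1 A^T J] for the symplectic form, with [J^-1 = - J]. It preserves integrality,
    and on a similitude of multiplier [e] it is [e] times the inverse. *)
Definition adj A := - (J *m A^T *m J).

Lemma adjM A B : adj (A *m B) = adj B *m adj A.
Proof.
rewrite /adj trmx_mul mulNmx mulmxN opprK -!mulmxA (mulmxA J J) JmxK.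
by rewrite !mulNmx mul1mx !mulmxN.
Qed.

Lemma adj1 : adj 1%:M = 1%:M.
Proof. by rewrite /adj trmx1 mulmx1 JmxK opprK. Qed.

Lemma adjD A B : adj (A + B) = adj A + adj B.
Proof. by rewrite /adj linearD /= mulmxDr mulmxDl opprD. Qed.

Lemma adjZ c A : adj (c *: A) = c *: adj A.
Proof. by rewrite /adj linearZ /= -scalemxAr -scalemxAl scalerN. Qed.

Lemma adjN A : adj (- A) = - adj A.
Proof. by rewrite -scaleN1r adjZ scaleN1r. Qed.

Lemma adjK A : adj (adj A) = A.
Proof.
rewrite /adj linearN /= !trmx_mul !trmxK !Jmx_tr.
rewrite !(mulNmx, mulmxN) !opprK !mulmxA JmxK !mulNmx mul1mx -mulmxA JmxK.
by rewrite mulmxN mulmx1 !opprK.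
Qed.

Lemma sim_adj e A : sim e A <-> adj A *m A = e%:M.
Proof.
have -> : adj A *m A = - J *m (A^T *m J *m A) by rewrite /adj !mulNmx !mulmxA.
rewrite /sim; split=> [->|/(congr1 (mulmx J))].
  by rewrite -scalemxAr mulNmx JmxK opprK scalemx1.
by rewrite mulmxA mulmxN JmxK opprK mul1mx mul_mx_scalar.
Qed.

Lemma sim_adjC e A : e != 0 -> sim e A -> A *m adj A = e%:M.
Proof.
move=> e0 /sim_adj h; have : (e^-1 *: adj A) *m A = 1%:M.
  by rewrite -scalemxAl h scale_scalar_mx mulVf.
move/mulmx1C; rewrite -scalemxAr => /(congr1 ( *:%R e)).
by rewrite scalerA mulfV // scale1r scalemx1.
Qed.

Lemma sim_unitmx e A : e != 0 -> sim e A -> A \in unitmx.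
Proof.
move=> e0 /(sim_adjC e0) h; have : A *m (e^-1 *: adj A) = 1%:M.
  by rewrite -scalemxAr h scale_scalar_mx mulVf.
by move/mulmx1_unit => [].
Qed.

Lemma sim_invmx e A : e != 0 -> sim e A -> invmx A = e^-1 *: adj A.
Proof.
move=> e0 h; have u := sim_unitmx e0 h.
by rewrite -[LHS]mulmx1 -[e^-1 *: _](mulKmx u) -scalemxAr (sim_adjC e0 h) scale_scalar_mx
           mulVf.
Qed.

Lemma sim_inv e A : e != 0 -> sim e A -> sim e^-1 (invmx A).
Proof.
move=> e0 h; have u := sim_unitmx e0 h; rewrite /sim.
rewrite -[J in LHS]scale1r -(mulVf e0) -scalerA -[e *: J]h.
rewrite -!(scalemxAl, scalemxAr) -!mulmxA mulmxV // mulmx1.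
by rewrite trmx_inv mulmxA mulVmx ?unitmx_tr // mul1mx.
Qed.

Lemma SpQ_invmx A : SpQ A -> invmx A = adj A.
Proof. by move=> /SpQ_sim h; rewrite (sim_invmx _ h) // invr1 scale1r. Qed.

Lemma integral_Jmx : integral_mx J.
Proof.
apply: integral_block_mx; rewrite ?oppr0; try exact: integral_mx0.
  exact: integral_mx1.
by apply: integral_mxN; apply: integral_mx1.
Qed.

Lemma integral_adj A : integral_mx A -> integral_mx (adj A).
Proof.
move=> hA; apply: integral_mxN; apply: integral_mxM; last exact: integral_Jmx.
by apply: integral_mxM; [exact: integral_Jmx | exact: integral_mx_tr].
Qed.

End Similitudes.

(** * Square roots of [1 + N] when [N ^ 3 = 0] *)

Section UnipotentSquareRoot.
Variable n : nat.
Implicit Types N : 'M[rat]_n.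

Definition poly3 N (a b c : rat) : 'M[rat]_n := a%:M + b *: N + c *: (N *m N).

(** The binomial series of [(1 + N)^(1/2)], cut after the square. *)
Definition usqrt N := poly3 N 1 (1 / 2) (- (1 / 8)).

Lemma poly3M N a b c a' b' c' : N *m N *m N = 0 ->
  poly3 N a b c *m poly3 N a' b' c' =
  poly3 N (a * a') (a * b' + b * a') (a * c' + b * b' + c * a').
Proof.
move=> N3; have N3' : N *m (N *m N) = 0 by rewrite mulmxA.
have N4 : N *m N *m (N *m N) = 0 by rewrite mulmxA N3 mul0mx.
rewrite /poly3 !mulmxDl !mulmxDr !mul_scalar_mx !mul_mx_scalar.
rewrite -!scalemxAl -!scalemxAr N3 N3' N4 !scaler0 !addr0 !scale_scalar_mx !scalerA.
rewrite !scalerDl !(mulrC a') !addrA; apply/matrixP=> i j; rewrite !mxE; ring.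
Qed.

Lemma poly3_1X N : 1%:M + N = poly3 N 1 1 0.
Proof. by rewrite /poly3 scale1r scale0r addr0. Qed.

Lemma poly3_1 N : 1%:M = poly3 N 1 0 0.
Proof. by rewrite /poly3 !scale0r !addr0. Qed.

Lemma usqrt_sqr N : N *m N *m N = 0 -> usqrt N *m usqrt N = 1%:M + N.
Proof. by move=> N3; rewrite /usqrt poly3M // poly3_1X; congr poly3; field. Qed.

Section Inverse.
Variables N N' : 'M[rat]_n.
Hypotheses (N3 : N *m N *m N = 0) (NN' : (1%:M + N) *m (1%:M + N') = 1%:M).

Lemma unipotent_inv : N' = N *m N - N.
Proof.
have e : poly3 N 1 (- 1) 1 *m (1%:M + N) = 1%:M.
  by rewrite poly3_1X poly3M // [RHS](poly3_1 N); congr poly3; ring.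
have e' : 1%:M + N' = poly3 N 1 (- 1) 1.
  by rewrite -[LHS]mul1mx -[X in X *m _]e -mulmxA NN' mulmx1.
rewrite -[LHS](addKr 1%:M) e' /poly3.
by move: (N *m N) => M; apply/matrixP=> i j; rewrite !mxE; ring.
Qed.

Lemma unipotent_inv_sqr : N' *m N' = N *m N.
Proof.
have N3' : N *m (N *m N) = 0 by rewrite mulmxA.
rewrite unipotent_inv mulmxBr !mulmxBl N3' N3 -mulmxA N3' mulmx0.
by rewrite !sub0r oppr0 add0r opprK.
Qed.

Lemma unipotent_inv_cube : N' *m N' *m N' = 0.
Proof. by rewrite unipotent_inv_sqr unipotent_inv mulmxBr mulmxA N3 mul0mx subr0. Qed.

(** Since [N' = N^2 - N], the second factor is the series [1 - N/2 + 3 N^2 / 8] of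
    [(1 + N)^(-1/2)]. *)
Lemma usqrt_inv : usqrt N *m usqrt N' = 1%:M.
Proof.
have -> : usqrt N' = poly3 N 1 (- (1 / 2)) (3 / 8).
  rewrite /usqrt /poly3 unipotent_inv_sqr unipotent_inv.
  by move: (N *m N) => M; apply/matrixP=> i j; rewrite !mxE; field.
by rewrite poly3M // [RHS](poly3_1 N); congr poly3; field.
Qed.

End Inverse.

Lemma usqrt_conj N (L L' : 'M[rat]_n) :
  L' *m L = 1%:M -> L *m usqrt N *m L' = usqrt (L *m N *m L').
Proof.
move=> LL; have LL' := mulmx1C LL.
rewrite /usqrt /poly3 !mulmxDr !mulmxDl mulmx1 LL' -!scalemxAr -!scalemxAl.
by rewrite -!mulmxA (mulmxA L' L) LL mul1mx.
Qed.

Lemma usqrt_comm N (A : 'M[rat]_n) : A *m N = N *m A -> A *m usqrt N = usqrt N *m A.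
Proof.
move=> h; rewrite /usqrt /poly3 !mulmxDr !mulmxDl -!scalemxAr -!scalemxAl mulmx1 mul1mx.
by rewrite !mulmxA !h -(mulmxA N A) h mulmxA.
Qed.

End UnipotentSquareRoot.

(** Together with [usqrt_inv], this makes the square root of a symplectic [1 + N] with [N ^ 3 = 0]
    symplectic. *)
Lemma adj_usqrt n (N : 'M[rat]_(n + n)) : adj (usqrt N) = usqrt (adj N).
Proof. by rewrite /usqrt /poly3 !adjD !adjZ adjM adj1. Qed.

(** * The parabolic subgroup stabilising F_q *)

Section Parabolic.
Variables q m : nat.
Local Notation n := (q + m)%N.
Local Notation J := (Jmx n).

(* Inclusions of [U = <e_(q+1), ..., e_n>], of the dual isotropic space [V], and of the
   symplectic space [S] of dimension [2 q] between them; the projections are the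
   transposes. *)
Definition iU : 'M[rat]_(n + n, m) := col_mx (col_mx 0 1%:M) 0.
Definition iV : 'M[rat]_(n + n, m) := col_mx 0 (col_mx 0 1%:M).
Definition iS : 'M[rat]_(n + n, q + q) :=
  block_mx (col_mx 1%:M 0) 0 0 (col_mx 1%:M 0).

Ltac blocks :=
  rewrite /iU /iV /iS ?tr_block_mx ?tr_col_mx ?trmx0 ?trmx1
    ?(mulmx_block, mul_row_col, mul_row_block, mul_block_col, mul_col_row, mul_mx_row,
      mul_col_mx, tr_col_mx, tr_row_mx, trmx0, trmx1, mul0mx, mulmx0, mul1mx, mulmx1,
      addr0, add0r, col_mx0, row_mx0, block_mx0, add_block_mx).

Lemma iUU : iU^T *m iU = 1%:M. Proof. by blocks. Qed.
Lemma iVV : iV^T *m iV = 1%:M. Proof. by blocks. Qed.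
Lemma iSS : iS^T *m iS = 1%:M. Proof. by blocks; rewrite -scalar_mx_block. Qed.
Lemma iUV : iU^T *m iV = 0. Proof. by blocks. Qed.
Lemma iVU : iV^T *m iU = 0. Proof. by blocks. Qed.
Lemma iUS : iU^T *m iS = 0. Proof. by blocks. Qed.
Lemma iVS : iV^T *m iS = 0. Proof. by blocks. Qed.
Lemma iSU : iS^T *m iU = 0. Proof. by blocks. Qed.
Lemma iSV : iS^T *m iV = 0. Proof. by blocks. Qed.

Lemma resolution : iU *m iU^T + iS *m iS^T + iV *m iV^T = 1%:M.
Proof. by blocks; rewrite -!scalar_mx_block. Qed.

Lemma J_iU : J *m iU = - iV.
Proof. by rewrite /Jmx; blocks; rewrite mulNmx mul1mx !opp_col_mx !oppr0. Qed.
Lemma J_iV : J *m iV = iU. Proof. by rewrite /Jmx; blocks. Qed.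
Lemma J_iS : J *m iS = iS *m Jmx q.
Proof. by rewrite /Jmx; blocks; rewrite mulNmx mul1mx opp_col_mx oppr0. Qed.

Lemma iU_J : iU^T *m J = iV^T.
Proof. by apply: trmx_inj; rewrite trmx_mul Jmx_tr !trmxK mulNmx J_iU opprK. Qed.
Lemma iS_J : iS^T *m J = Jmx q *m iS^T.
Proof.
by apply: trmx_inj; rewrite !trmx_mul !Jmx_tr !trmxK mulNmx mulmxN J_iS.
Qed.

Definition ii := (iUU, iVV, iSS, iUV, iVU, iUS, iVS, iSU, iSV).

Lemma mx_ext p (A B : 'M[rat]_(n + n, p)) :
  iU^T *m A = iU^T *m B -> iS^T *m A = iS^T *m B -> iV^T *m A = iV^T *m B -> A = B.
Proof.
move=> hU hS hV; rewrite -[A]mul1mx -[B]mul1mx -resolution !mulmxDl -!mulmxA.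
by rewrite hU hS hV.
Qed.

Lemma mx_extr p (A B : 'M[rat]_(p, n + n)) :
  A *m iU = B *m iU -> A *m iS = B *m iS -> A *m iV = B *m iV -> A = B.
Proof.
move=> hU hS hV; rewrite -[A]mulmx1 -[B]mulmx1 -resolution !mulmxDr !mulmxA.
by rewrite hU hS hV.
Qed.

Definition UU (A : 'M[rat]_(n + n)) := iU^T *m A *m iU.
Definition SS (A : 'M[rat]_(n + n)) := iS^T *m A *m iS.
Definition VV (A : 'M[rat]_(n + n)) := iV^T *m A *m iV.

(** Block upper triangular for the order [U], [S], [V], that is, preserving the flag [U] inside
    [U^perp = U + S]. *)
Definition par (A : 'M[rat]_(n + n)) : Prop :=
  [/\ iS^T *m A *m iU = 0, iV^T *m A *m iU = 0 & iV^T *m A *m iS = 0].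

Lemma par_iU A : par A -> A *m iU = iU *m UU A.
Proof.
by case=> hS hV _; apply: mx_ext; rewrite !mulmxA !ii ?mul0mx ?mul1mx.
Qed.

Lemma par_iV A : par A -> iV^T *m A = VV A *m iV^T.
Proof.
by case=> _ hU hS; apply: mx_extr; rewrite -[in RHS]mulmxA !ii ?mulmx0 ?mulmx1.
Qed.

Lemma par_iS A : par A -> A *m iS = iS *m SS A + iU *m (iU^T *m A *m iS).
Proof.
case=> _ _ hS; apply: mx_ext; rewrite mulmxDr !mulmxA !ii;
  by rewrite !(mul0mx, mul1mx, addr0, add0r).
Qed.

Lemma par1 : par 1%:M.
Proof. by split; rewrite mulmx1 ii. Qed.

Lemma parD A B : par A -> par B -> par (A + B).
Proof.
by move=> [a b e] [a' b' e']; split; rewrite mulmxDr mulmxDl ?a ?a' ?b ?b' ?e ?e' addr0.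
Qed.

Lemma parZ c A : par A -> par (c *: A).
Proof. by move=> [a b e]; split; rewrite -scalemxAr -scalemxAl ?a ?b ?e scaler0. Qed.

Lemma parN A : par A -> par (- A).
Proof. by rewrite -scaleN1r; apply: parZ. Qed.

Lemma parM A B : par A -> par B -> par (A *m B).
Proof.
move=> hA hB; split; rewrite !mulmxA.
- by rewrite -!mulmxA (par_iU hB) (mulmxA A) (par_iU hA) !mulmxA ii !mul0mx.
- by rewrite -!mulmxA (par_iU hB) (mulmxA A) (par_iU hA) !mulmxA ii !mul0mx.
- by rewrite (par_iV hA) -(mulmxA _ _ B) (par_iV hB) -!mulmxA ii !mulmx0.
Qed.

Lemma SS_M A B : par A -> par B -> SS (A *m B) = SS A *m SS B.
Proof.
move=> [hA _ _] hB; rewrite [SS (A *m B)]/SS -!mulmxA (par_iS hB) !mulmxDr !mulmxA hA.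
by rewrite !mul0mx addr0.
Qed.

Lemma UU_M A B : par A -> par B -> UU (A *m B) = UU A *m UU B.
Proof.
move=> /par_iU + /par_iU; move: (UU A) (UU B) => a b ea eb.
by rewrite /UU -!mulmxA eb (mulmxA A) ea !mulmxA ii mul1mx.
Qed.

Lemma VV_M A B : par A -> par B -> VV (A *m B) = VV A *m VV B.
Proof.
move=> /par_iV + /par_iV; move: (VV A) (VV B) => a b ea eb.
by rewrite /VV !mulmxA ea -(mulmxA _ _ B) eb -!mulmxA ii mulmx1.
Qed.

Lemma UU1 : UU 1%:M = 1%:M. Proof. by rewrite /UU mulmx1 ii. Qed.
Lemma SS1 : SS 1%:M = 1%:M. Proof. by rewrite /SS mulmx1 ii. Qed.
Lemma VV1 : VV 1%:M = 1%:M. Proof. by rewrite /VV mulmx1 ii. Qed.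
Lemma UU_D A B : UU (A + B) = UU A + UU B. Proof. by rewrite /UU mulmxDr mulmxDl. Qed.
Lemma SS_D A B : SS (A + B) = SS A + SS B. Proof. by rewrite /SS mulmxDr mulmxDl. Qed.
Lemma VV_D A B : VV (A + B) = VV A + VV B. Proof. by rewrite /VV mulmxDr mulmxDl. Qed.
Lemma UU_Z c A : UU (c *: A) = c *: UU A. Proof. by rewrite /UU -scalemxAr -scalemxAl. Qed.
Lemma SS_Z c A : SS (c *: A) = c *: SS A. Proof. by rewrite /SS -scalemxAr -scalemxAl. Qed.
Lemma VV_Z c A : VV (c *: A) = c *: VV A. Proof. by rewrite /VV -scalemxAr -scalemxAl. Qed.

(** Such an [N] is strictly block triangular with three blocks: it sends everything into [U + S],
    that into [U], and [U] to 0. *)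
Lemma par_nilpotent N : par N -> UU N = 0 -> SS N = 0 -> VV N = 0 -> N *m N *m N = 0.
Proof.
move=> hN hU hS hV.
have nU : N *m iU = 0 by rewrite (par_iU hN) hU mulmx0.
have nV : iV^T *m N = 0 by rewrite (par_iV hN) hV mul0mx.
have nS : N *m N *m iS = 0.
  by rewrite -mulmxA (par_iS hN) hS mulmx0 add0r mulmxA nU mul0mx.
have eN : N = iU *m (iU^T *m N) + iS *m (iS^T *m N).
  by rewrite -[LHS]mul1mx -resolution !mulmxDl -!mulmxA nV mulmx0 addr0.
rewrite [X in _ *m X]eN mulmxDr !mulmxA nS -(mulmxA N N iU) nU mulmx0.
by rewrite !mul0mx addr0.
Qed.

(** A similitude stabilising [U] stabilises [U^perp]: pairing with [U] forces [s] to be invertible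
    and the rows of [A] along [V] to be [e s^(-T) iV^T]. *)
Lemma sim_par e A (s : 'M[rat]_m) : e != 0 -> sim e A -> A *m iU = iU *m s -> par A.
Proof.
move=> e0 hA hs.
have hV : s^T *m (iV^T *m A) = e *: iV^T.
  have := congr1 (mulmx iU^T) hA.
  rewrite -scalemxAr iU_J !mulmxA -trmx_mul hs trmx_mul -(mulmxA _ _ J) iU_J.
  by rewrite -!mulmxA.
have us : s^T \in unitmx.
  have : s^T *m (e^-1 *: VV A) = 1%:M.
    by rewrite -scalemxAr /VV mulmxA hV -scalemxAl ii scalerA mulVf // scale1r.
  by move/mulmx1_unit => [].
have {}hV : iV^T *m A = e *: (invmx s^T *m iV^T) by rewrite scalemxAr -hV mulKmx.
by split; rewrite ?hV -?scalemxAl -?(mulmxA _ A iU) ?hs ?mulmxA -?(mulmxA (invmx s^T)) !ii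
  ?mul0mx ?mulmx0 ?scaler0.
Qed.

(** [U] and [V] are dual under the form, so the two outer diagonal blocks are contragredient up to
    the multiplier. *)
Lemma sim_UU_VV e A : sim e A -> par A -> (UU A)^T *m VV A = e%:M.
Proof.
move=> hA pA; have : iU^T *m (A^T *m J *m A) *m iV = e%:M.
  by rewrite hA -scalemxAr iU_J -scalemxAl ii scalemx1.
rewrite !mulmxA -trmx_mul (par_iU pA) trmx_mul -(mulmxA _ _ J) iU_J.
by rewrite -(mulmxA _ _ A) (par_iV pA) -!mulmxA ii mulmx1.
Qed.

Lemma sim_SS e A : sim e A -> par A -> sim e (SS A).
Proof.
move=> hA pA; have : iS^T *m (A^T *m J *m A) *m iS = e *: Jmx q.
  by rewrite hA -scalemxAr iS_J -scalemxAl -mulmxA ii mulmx1.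
have -> : iS^T *m (A^T *m J *m A) *m iS = (A *m iS)^T *m J *m (A *m iS).
  by rewrite trmx_mul !mulmxA.
rewrite (par_iS pA) /sim; move: (SS A) (iU^T *m A *m iS) => S X <-.
rewrite [(_ + _)^T]linearD /= !trmx_mul !mulmxDl -!(mulmxA _ _ J) iU_J iS_J !mulmxDr.
rewrite -!mulmxA !(mulmxA iV^T, mulmxA iS^T) !ii.
by rewrite !(mul0mx, mulmx0, addr0, mul1mx).
Qed.

Definition levi (s : 'M[rat]_m) (S : 'M[rat]_(q + q)) (t : 'M[rat]_m) : 'M[rat]_(n + n) :=
  iU *m s *m iU^T + iS *m S *m iS^T + iV *m t *m iV^T.

Lemma levi_iU s S t : levi s S t *m iU = iU *m s.
Proof. by rewrite !mulmxDl -!mulmxA !ii !mulmx0 mulmx1 !addr0. Qed.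
Lemma levi_iS s S t : levi s S t *m iS = iS *m S.
Proof. by rewrite !mulmxDl -!mulmxA !ii !mulmx0 mulmx1 addr0 add0r. Qed.
Lemma levi_iV s S t : levi s S t *m iV = iV *m t.
Proof. by rewrite !mulmxDl -!mulmxA !ii !mulmx0 mulmx1 !add0r. Qed.

Lemma levi_par s S t : par (levi s S t).
Proof. by split; rewrite -mulmxA ?levi_iU ?levi_iS mulmxA ii mul0mx. Qed.
Lemma levi_UU s S t : UU (levi s S t) = s.
Proof. by rewrite /UU -mulmxA levi_iU mulmxA ii mul1mx. Qed.
Lemma levi_SS s S t : SS (levi s S t) = S.
Proof. by rewrite /SS -mulmxA levi_iS mulmxA ii mul1mx. Qed.
Lemma levi_VV s S t : VV (levi s S t) = t.
Proof. by rewrite /VV -mulmxA levi_iV mulmxA ii mul1mx. Qed.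

Lemma leviM s S t s' S' t' :
  levi s S t *m levi s' S' t' = levi (s *m s') (S *m S') (t *m t').
Proof.
by apply: mx_extr; rewrite -mulmxA ?levi_iU ?levi_iS ?levi_iV mulmxA
  ?levi_iU ?levi_iS ?levi_iV mulmxA.
Qed.

Lemma levi1 : levi 1%:M 1%:M 1%:M = 1%:M.
Proof. by rewrite /levi !mulmx1 resolution. Qed.

Lemma levi_sim e s S t : s^T *m t = e%:M -> sim e S -> sim e (levi s S t).
Proof.
move=> hst hS; have hts : t^T *m s = e%:M by rewrite -[s]trmxK -trmx_mul hst tr_scalar_mx.
have hT : (levi s S t)^T = levi s^T S^T t^T.
  by rewrite /levi !linearD /= !trmx_mul !trmxK !mulmxA.
apply: mx_extr; rewrite -mulmxA ?levi_iU ?levi_iS ?levi_iV hT -scalemxAl -mulmxA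
  [J *m (_ *m _)]mulmxA ?J_iU ?J_iS ?J_iV ?mulNmx ?mulmxN !mulmxA
  ?levi_iU ?levi_iS ?levi_iV -!mulmxA.
- by rewrite hts mul_mx_scalar scalerN.
- by rewrite [S^T *m _]mulmxA hS -scalemxAr.
- by rewrite hst mul_mx_scalar.
Qed.

Lemma integral_iU : integral_mx iU.
Proof.
by do ?[apply: integral_col_mx | exact: integral_mx0 | exact: integral_mx1].
Qed.
Lemma integral_iV : integral_mx iV.
Proof.
by do ?[apply: integral_col_mx | exact: integral_mx0 | exact: integral_mx1].
Qed.
Lemma integral_iS : integral_mx iS.
Proof.
by apply: integral_block_mx; do ?[apply: integral_col_mx | exact: integral_mx0 | exact: integral_mx1].
Qed.

End Parabolic.

Lemma par_usqrt q m (N : 'M[rat]_((q + m) + (q + m))) : par N -> par (usqrt N).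
Proof.
move=> h; apply: parD; last by apply: parZ; apply: parM.
by apply: parD; [exact: par1 | exact: parZ].
Qed.

Lemma SS_usqrt q m (N : 'M[rat]_((q + m) + (q + m))) :
  par N -> SS N = 0 -> SS (usqrt N) = 1%:M.
Proof.
move=> h h0; rewrite /usqrt /poly3 !SS_D !SS_Z SS_M // h0 mulmx0 !scaler0 !addr0.
exact: SS1.
Qed.

Lemma UU_usqrt q m (N : 'M[rat]_((q + m) + (q + m))) :
  par N -> UU N = 0 -> UU (usqrt N) = 1%:M.
Proof.
move=> h h0; rewrite /usqrt /poly3 !UU_D !UU_Z UU_M // h0 mulmx0 !scaler0 !addr0.
exact: UU1.
Qed.

Lemma VV_usqrt q m (N : 'M[rat]_((q + m) + (q + m))) :
  par N -> VV N = 0 -> VV (usqrt N) = 1%:M.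
Proof.
move=> h h0; rewrite /usqrt /poly3 !VV_D !VV_Z VV_M // h0 mulmx0 !scaler0 !addr0.
exact: VV1.
Qed.

(** * Replacing an antisymplectic matrix by a congruent involution *)

Section InvolutionLift.
Variables (k q m : nat).
Local Notation n := (q + m)%N.
Variables (sg P : 'M[rat]_(n + n)).
Hypotheses (sg_sim : sim (- 1) sg) (sg_par : par sg) (sgS : SS sg *m SS sg = 1%:M).
Hypotheses (intP : integral_mx P) (PP : P *m P = P).
Hypothesis (sgP : congr_mx (2 ^ k.+1) sg (1%:M - 2 *: P)).

(** Halving costs one power of 2, whence the two exponents [k.+1] and [k]. *)
Lemma congr_half (A B : 'M[rat]_(n + n)) :
  congr_mx (2 ^ k.+1) A (1%:M - 2 *: B) -> congr_mx (2 ^ k) ((1 / 2) *: (1%:M - A)) B.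
Proof.
case=> C hC e; exists (- C); first exact: integral_mxN.
have -> : A = 1%:M - 2 *: B + (2 ^ k.+1)%:R *: C by rewrite -e addrC subrK.
by rewrite expnS natrM; apply/matrixP=> i j; rewrite !mxE; field.
Qed.

Lemma half_idem (A : 'M[rat]_(n + n)) : congr_mx (2 ^ k) A P ->
  congr_mx (2 ^ k) (A *m A) A.
Proof.
move=> h; have iA := congr_mx_integral h intP.
apply: (congr_mx_trans (congr_mxMl iA h)).
apply: (congr_mx_trans (congr_mxMr intP h)).
by rewrite PP; apply: congr_mx_sym.
Qed.

Lemma involution_lift : exists sg1 : 'M[rat]_(n + n),
  [/\ sim (- 1) sg1, par sg1, SS sg1 = SS sg, sg1 *m sg1 = 1%:M
    & congr_mx (2 ^ k.+1) sg1 sg].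
Proof.
have int2 : (2 : rat) \is a Num.int by rewrite rpred_nat.
have int_sg : integral_mx sg.
  apply: congr_mx_integral sgP _; apply: integral_mxB; first exact: integral_mx1.
  exact: integral_mxZ.
pose p := (1 / 2) *: (1%:M - sg).
have pP : congr_mx (2 ^ k) p P by apply: congr_half.
have par_p : par p by apply: parZ; apply: parD; [exact: par1 | exact: parN].
have int_p := congr_mx_integral pP intP.
have iUt := integral_mx_tr (@integral_iU q m).
have iVt := integral_mx_tr (@integral_iV q m).
have intUU A : integral_mx A -> integral_mx (@UU q m A).
  by move=> hA; do 2?apply: integral_mxM => //; exact: integral_iU.
have intVV A : integral_mx A -> integral_mx (@VV q m A).
  by move=> hA; do 2?apply: integral_mxM => //; exact: integral_iV.
(* Only the [U] block is lifted; the [V] block will follow by duality. *)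
have [|b bb [int_b ba]] := @idempotent_lift k m (UU p) (intUU _ int_p).
  rewrite -UU_M //; apply: congr_mxMr; first exact: integral_iU.
  by apply: congr_mxMl => //; apply: half_idem.
pose s := UU sg; pose t := VV sg; pose s1 := 1%:M - 2 *: b.
have int_s : integral_mx s by apply: intUU.
have int_t : integral_mx t by apply: intVV.
have int_s1 : integral_mx s1.
  by apply: integral_mxB; [exact: integral_mx1 | exact: integral_mxZ].
have s1s1 : s1 *m s1 = 1%:M.
  rewrite /s1 mulmxBr !mulmxBl mulmx1 mul1mx mulmx1 -scalemxAr -scalemxAl bb.
  by apply/matrixP=> i j; rewrite !mxE; ring.
have s1s : congr_mx (2 ^ k.+1) s1 s.
  case: ba => C hC e; exists (- C); first exact: integral_mxN.
  have -> : s = 1%:M - 2 *: UU p.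
    rewrite /p UU_Z scalerA (_ : 2 * (1 / 2) = 1) // scale1r.
    by rewrite UU_D UU1 -[- sg]scaleN1r UU_Z scaleN1r opprB addrC subrK.
  rewrite /s1 expnS natrM -scalerA scalerN -e.
  by move: (UU p) => a; apply/matrixP=> i j; rewrite !mxE; ring.
have st : s^T *m t = - 1%:M by rewrite (sim_UU_VV sg_sim sg_par) raddfN.
have tst : t^T *m s = - 1%:M by rewrite -[s]trmxK -trmx_mul st linearN /= trmx1.
have stt : s *m - t^T = 1%:M by apply: mulmx1C; rewrite mulNmx tst opprK.
(* As [s^-1 = - t^T], [x] is [s^-1 s1] and [y] its inverse transpose: the Levi element [l] is
   symplectic, congruent to 1, and turns the [U] block [s] of [sg] into [s1]. *)
pose x := - t^T *m s1; pose y := (s1 *m s)^T.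
have int_tt : integral_mx (- t^T) by apply: integral_mxN; apply: integral_mx_tr.
have sx : s *m x = s1 by rewrite mulmxA stt mul1mx.
have xy : x^T *m y = 1%:M.
  by rewrite -trmx_mul -mulmxA sx s1s1 trmx1.
pose l := @levi q m x 1%:M y.
have l_sim : sim 1 l by apply: levi_sim => //; exact: sim1.
have l_par : par l by exact: levi_par.
have l1 : congr_mx (2 ^ k.+1) l 1%:M.
  rewrite -(levi1 q m) /l /levi; apply: congr_mxD.
    apply: congr_mxD; last exact: congr_mx_refl.
    apply: congr_mxMr => //; apply: congr_mxMl; first exact: integral_iU.
    by rewrite -(mulmx1C stt); apply: congr_mxMl.
  apply: congr_mxMr => //; apply: congr_mxMl; first exact: integral_iV.
  rewrite -trmx1; apply: congr_mx_tr; rewrite -s1s1; apply: congr_mxMl => //.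
  exact: congr_mx_sym.
pose g := sg *m l.
have g_sim : sim (- 1) g by rewrite -[- 1]mulr1; apply: simM.
have g_par : par g by apply: parM.
have gsg : congr_mx (2 ^ k.+1) g sg.
  by rewrite -[sg in X in congr_mx _ _ X]mulmx1; apply: congr_mxMl.
have gU : UU g = s1 by rewrite UU_M // levi_UU.
have gS : SS g = SS sg by rewrite SS_M // levi_SS mulmx1.
have gV : VV g *m VV g = 1%:M.
  have e : VV g = - s1^T.
    have := sim_UU_VV g_sim g_par; rewrite gU => /(congr1 (mulmx s1^T)).
    by rewrite mulmxA -trmx_mul s1s1 trmx1 mul1mx raddfN mulmxN mulmx1.
  by rewrite e mulNmx mulmxN opprK -trmx_mul s1s1 trmx1.
(* The three diagonal blocks of [g] are now involutions, so [g^2 = 1 + N] is unipotent. *)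
clearbody g; have [N eN] : exists N, N = g *m g - 1%:M by exists (g *m g - 1%:M).
have N_par : par N by rewrite eN; apply: parD; [exact: parM | apply: parN; exact: par1].
have N3 : N *m N *m N = 0.
  apply: (par_nilpotent N_par); rewrite eN -scaleN1r.
  - by rewrite UU_D UU_Z UU1 UU_M // gU s1s1 scaleN1r subrr.
  - by rewrite SS_D SS_Z SS1 SS_M // gS sgS scaleN1r subrr.
  - by rewrite VV_D VV_Z VV1 VV_M // gV scaleN1r subrr.
have SSN : SS N = 0 by rewrite eN -scaleN1r SS_D SS_Z SS1 SS_M // gS sgS scaleN1r subrr.
have e1N : 1%:M + N = g *m g by rewrite eN addrC subrK.
have e1N' : 1%:M + adj N = adj (g *m g) by rewrite -e1N [RHS]adjD adj1.
have ag : adj g *m g = - 1%:M by move/sim_adj: g_sim; rewrite raddfN.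
have ga : g *m adj g = - 1%:M by rewrite (sim_adjC _ g_sim) ?raddfN.
have NN' : (1%:M + N) *m (1%:M + adj N) = 1%:M.
  by rewrite e1N e1N' adjM -!mulmxA (mulmxA g (adj g)) ga mulNmx mul1mx mulmxN ga opprK.
have eN' := unipotent_inv N3 NN'.
have gN : g *m N = N *m g by rewrite eN mulmxBr mulmxBl mulmx1 mul1mx mulmxA.
have gN' : g *m adj N = adj N *m g.
  by rewrite eN' mulmxBr mulmxBl gN mulmxA gN -mulmxA gN mulmxA.
have N'_par : par (adj N) by rewrite eN'; apply: parD; [exact: parM | exact: parN].
have SSN' : SS (adj N) = 0.
  by rewrite eN' -scaleN1r SS_D SS_Z SS_M // SSN mulmx0 scaler0 addr0.
(* [1 + adj N] is the inverse of the symplectic matrix [g^2], so [r] is [(g^2)^(-1/2)]; it commutes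
   with [g], and [(g r)^2 = 1]. *)
pose r := usqrt (adj N).
have r_par : par r by exact: par_usqrt.
exists (g *m r); split.
- apply/sim_adj; rewrite adjM adj_usqrt adjK mulmxA -(mulmxA _ (adj g)) ag.
  by rewrite mulmxN mulmx1 mulNmx (usqrt_inv N3 NN') raddfN.
- exact: parM.
- by rewrite SS_M // SS_usqrt // mulmx1.
- rewrite -mulmxA (mulmxA r) -(usqrt_comm gN') -mulmxA mulmxA.
  by rewrite (usqrt_sqr (unipotent_inv_cube N3 NN')) -e1N.
- apply: (congr_mx_trans _ gsg); rewrite -[g in X in congr_mx _ _ X]mulmx1.
  apply: congr_mxMl; first exact: (congr_mx_integral gsg).
  (* For [A = (1 - g) / 2] one has [A^2 - A = N / 4], and [A] is idempotent modulo [2 ^ k]; hence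
     [2 ^ (k + 2)] divides [N]. *)
  have : congr_mx (2 ^ k) ((1 / 2) *: (1%:M - g)) P.
    by apply: congr_half; apply: (congr_mx_trans gsg sgP).
  move=> /half_idem[C hC eC].
  have NC : N = (2 ^ k.+2)%:R *: C.
    rewrite !expnS !natrM -!scalerA -eC eN.
    rewrite -scalemxAl -scalemxAr mulmxBr !mulmxBl mulmx1 mul1mx mulmx1.
    by move: (g *m g) => G; apply/matrixP=> i j; rewrite !mxE; field.
  (* [r - 1 = - N/2 + 3 N^2 / 8], and [N = 2 ^ (k + 2) C] absorbs both denominators, leaving a
     factor [2 ^ (k + 1)]. *)
  exists (- C + (3 * 2 ^ k)%:R *: (C *m C)).
    apply: integral_mxD; first exact: integral_mxN.
    by apply: integral_mxZ; [rewrite rpred_nat | exact: integral_mxM].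
  rewrite /r /usqrt /poly3 (unipotent_inv_sqr N3 NN') eN' NC -scalemxAl -scalemxAr.
  move: (C *m C) => CC; rewrite !expnS !natrM natrX.
  by apply/matrixP=> i j; rewrite !mxE; field.
Qed.

End InvolutionLift.

(** * Integral adapted bases *)

Lemma common_denominator r c (G : 'M[rat]_(r, c)) :
  exists2 d : rat, d != 0 & integral_mx (d *: G).
Proof.
exists (\prod_(ij : 'I_r * 'I_c) (denq (G ij.1 ij.2))%:~R).
  by apply/prodf_neq0 => ij _; rewrite intr_eq0 denq_neq0.
move=> i j; rewrite mxE (bigD1 (i, j)) //= mulrAC rpredM //.
  rewrite -[X in _ * X]divq_num_den mulrC divfK ?intr_eq0 ?denq_neq0 //.
  exact: intr_int.
by apply: rpred_prod => ij _; exact: intr_int.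
Qed.

(** By the Smith form of an integral multiple of [G], the first [c] columns of the unimodular [L]
    are a basis of a primitive lattice whose rational span contains the columns of [G]. Elementary
    divisors and the denominator go into [T]. *)
Lemma saturation r c (G : 'M[rat]_(c + r, c)) :
  exists L L' : 'M[rat]_(c + r), exists T : 'M[rat]_c,
  [/\ integral_mx L, integral_mx L', L *m L' = 1%:M & G = L *m col_mx 1%:M 0 *m T].
Proof.
have [d d0 /integral_mxP[G' eG]] := common_denominator G.
have [L uL [R _ [s _ eG']]] := int_Smith_normal_form G'.
have eD : (\matrix_(i < c + r, j < c) (s`_i *+ (i == j :> nat)) : 'M[int]__)
    = col_mx 1%:M 0 *m (\matrix_(i < c, j < c) (s`_i *+ (i == j :> nat))).
  rewrite mul_col_mx mul1mx mul0mx; apply/matrixP=> i j; rewrite !mxE.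
  case: splitP => i' ei; rewrite !mxE ei //.
  by rewrite gtn_eqF // ltn_addr.
rewrite {}eD in eG'; move: (\matrix_(i, j) _) eG' => D eG'.
exists (map_mx intr L), (map_mx intr (invmx L)), (d^-1 *: map_mx intr (D *m R)).
split; try exact: integral_mx_intr.
  by rewrite -map_mxM mulmxV // map_mx1.
rewrite -scalemxAr; apply: (canRL (scalerK d0)); rewrite eG eG'.
by rewrite !map_mxM map_col_mx map_mx1 map_mx0 !mulmxA.
Qed.

(** Exchanging the two blocks by [W] moves the adapted basis to the last [m] columns, which is where
    [U] has its basis. *)
Lemma saturation_r q m (G : 'M[rat]_(q + m, m)) :
  exists L L' : 'M[rat]_(q + m), exists T : 'M[rat]_m,
  [/\ integral_mx L, integral_mx L', L *m L' = 1%:M & G = L *m col_mx 0 1%:M *m T].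
Proof.
pose W : 'M[rat]_(q + m, m + q) := block_mx 0 1%:M 1%:M 0.
pose W' : 'M[rat]_(m + q, q + m) := block_mx 0 1%:M 1%:M 0.
have WW' : W *m W' = 1%:M.
  by rewrite mulmx_block !mulmx0 !mulmx1 !addr0 add0r -scalar_mx_block.
have W'W : W' *m W = 1%:M.
  by rewrite mulmx_block !mulmx0 !mulmx1 !addr0 add0r -scalar_mx_block.
have iW : integral_mx W.
  by apply: integral_block_mx; try exact: integral_mx0; exact: integral_mx1.
have iW' : integral_mx W'.
  by apply: integral_block_mx; try exact: integral_mx0; exact: integral_mx1.
have [L [L' [T [iL iL' LL' e]]]] := saturation (W' *m G).
exists (W *m L *m W'), (W *m L' *m W'), T; split.
- by apply: integral_mxM => //; apply: integral_mxM.
- by apply: integral_mxM => //; apply: integral_mxM.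
- by rewrite !mulmxA -(mulmxA _ W') W'W mulmx1 -(mulmxA W) LL' mulmx1.
- rewrite -[G]mul1mx -WW' -mulmxA e.
  have -> : col_mx 1%:M 0 = W' *m col_mx 0 1%:M :> 'M[rat]__.
    by rewrite mul_block_col !(mul0mx, mul1mx, addr0, add0r).
  by rewrite !mulmxA.
Qed.

(** The strictly upper triangular part serves, because the diagonal of [K] vanishes. *)
Lemma alternating_split n (K : 'M[rat]_n) : integral_mx K -> K^T = - K ->
  exists2 S, integral_mx S & S - S^T = K.
Proof.
move=> iK aK; exists (\matrix_(i, j) if (i < j)%N then K i j else 0).
  by move=> i j; rewrite mxE; case: ifP.
have aKij i j : K j i = - K i j by move/matrixP/(_ i j): aK; rewrite !mxE.
apply/matrixP=> i j; rewrite !mxE; case: (ltngtP i j) => [||/val_inj ->].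
- by rewrite subr0.
- by rewrite sub0r -aKij.
- by have := aKij j j; lra.
Qed.

(** The columns of [g0] are an integral symplectic basis adapted to the flag formed by [g U] and the
    Lagrangian [g <e_1, ..., e_n>]. This exchanges a rational [g] for an integral one, conjugation
    by which respects congruences. *)
Lemma SpQ_iwasawa q m (g : 'M[rat]_((q + m) + (q + m))) : SpQ g ->
  exists g0 h : 'M[rat]_((q + m) + (q + m)),
  [/\ SpZ g0, SpQ h, par h & g = g0 *m h].
Proof.
move=> hg; set n := (q + m)%N in g hg *.
pose f : 'M[rat]_(n + n, n) := col_mx 1%:M 0.
have fJf : f^T *m Jmx n *m f = 0.
  rewrite /f /Jmx tr_col_mx trmx1 trmx0 mul_row_block mul_row_col.
  by rewrite !(mul0mx, mulmx0, mul1mx, mulmx1, addr0).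
have [L [L' [T [iL iL' LL' eG]]]] := saturation (g *m f).
rewrite -/f in eG.
(* [X] is an integral basis of a primitive lattice in the Lagrangian [g f]; its integral left
   inverse [X'] will provide the dual vectors [Y0]. *)
pose X := L *m f; pose X' := f^T *m L'.
have ff : f^T *m f = 1%:M.
  by rewrite /f tr_col_mx trmx1 trmx0 mul_row_col mulmx1 mulmx0 addr0.
have X'X : X' *m X = 1%:M.
  by rewrite /X /X' mulmxA -(mulmxA _ L') (mulmx1C LL') mulmx1.
have ug : g \in unitmx by apply: (@sim_unitmx _ 1); rewrite ?oner_eq0 //; apply/SpQ_sim.
have uT : T \in unitmx.
  have : (f^T *m invmx g *m X) *m T = 1%:M.
    by rewrite -(mulmxA _ X) /X -eG mulmxA mulmxKV.
  by move/mulmx1_unit => [].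
have eX : X = g *m f *m invmx T by rewrite eG mulmxK.
have if_ : integral_mx f.
  by apply: integral_col_mx; [exact: integral_mx1 | exact: integral_mx0].
have iX : integral_mx X by apply: integral_mxM.
have iX' : integral_mx X' by apply: integral_mxM => //; apply: integral_mx_tr.
have XJX : X^T *m Jmx n *m X = 0.
  rewrite eX !trmx_mul.
  have -> : (invmx T)^T *m (f^T *m g^T) *m Jmx n *m (g *m f *m invmx T)
     = (invmx T)^T *m (f^T *m (g^T *m Jmx n *m g) *m f) *m invmx T by rewrite !mulmxA.
  by rewrite hg fJf mulmx0 mul0mx.
(* The unimodular change of basis [V] makes the last [m] columns of [X V] span [g U]. *)
have [V [V' [B [iV iV' VV' eT]]]] := @saturation_r q m (T *m col_mx 0 1%:M).
have V'V := mulmx1C VV'.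
have eGX : g *m f = X *m T by [].
clearbody X X'.
pose Y0 := - (Jmx n *m X'^T).
have iY0 : integral_mx Y0.
  apply: integral_mxN; apply: integral_mxM; first exact: integral_Jmx.
  exact: integral_mx_tr.
have XJY0 : X^T *m Jmx n *m Y0 = 1%:M.
  rewrite /Y0 mulmxN mulmxA -(mulmxA X^T) JmxK mulmxN mulNmx opprK mulmx1.
  by rewrite -trmx_mul X'X trmx1.
clearbody Y0.
have trJ (A C : 'M[rat]_(n + n, n)) : (A^T *m Jmx n *m C)^T = - (C^T *m Jmx n *m A).
  by rewrite !trmx_mul trmxK Jmx_tr mulNmx mulmxN mulmxA.
have Y0JX : Y0^T *m Jmx n *m X = - 1%:M.
  by rewrite -[LHS]opprK -trJ XJY0 trmx1.
have [S iS_ eS] : exists2 S, integral_mx S & S - S^T = Y0^T *m Jmx n *m Y0.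
  apply: alternating_split; last exact: trJ.
  apply: integral_mxM => //; apply: integral_mxM; first exact: integral_mx_tr.
  exact: integral_Jmx.
(* Adding [X S] keeps the pairing with [X] and cancels the form on [Y0], whose Gram matrix is
   [S - S^T]. *)
pose Y := Y0 + X *m S.
have iY : integral_mx Y by apply: integral_mxD => //; apply: integral_mxM.
have XJY : X^T *m Jmx n *m Y = 1%:M.
  by rewrite mulmxDr XJY0 mulmxA XJX mul0mx addr0.
have YJX : Y^T *m Jmx n *m X = - 1%:M by rewrite -[LHS]opprK -trJ XJY trmx1.
have YJY : Y^T *m Jmx n *m Y = 0.
  rewrite {2}/Y mulmxDr mulmxA YJX mulNmx mul1mx /Y linearD /= trmx_mul !mulmxDl.
  by rewrite -eS -!mulmxA (mulmxA X^T) XJY0 mulmx1 subrK subrr.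
clearbody Y.
(* The contragredient [V'^T] acts on [Y] to keep the basis symplectic. *)
pose g0 : 'M[rat]_(n + n) := row_mx (X *m V) (Y *m V'^T).
have hg0 : SpQ g0.
  have bl (A C : 'M[rat]_(n + n, n)) (M N : 'M[rat]_n) :
      (A *m M)^T *m Jmx n *m (C *m N) = M^T *m (A^T *m Jmx n *m C) *m N.
    by rewrite trmx_mul !mulmxA.
  rewrite /SpQ /g0 tr_row_mx mul_col_mx mul_col_row !bl XJX XJY YJX YJY !trmxK.
  rewrite !(mul0mx, mulmx0, mulmx1, mulNmx, mulmxN).
  by rewrite -trmx_mul V'V trmx1.
have ig0 : integral_mx g0.
  by apply: integral_row_mx; apply: integral_mxM => //; apply: integral_mx_tr.
have ug0 : g0 \in unitmx by apply: (@sim_unitmx _ 1); rewrite ?oner_eq0 //; apply/SpQ_sim.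
have hh : sim 1 (invmx g0 *m g).
  rewrite -[1]mulr1; apply: simM; last exact/SpQ_sim.
  by rewrite -[1]invr1; apply: sim_inv; rewrite ?oner_eq0 //; apply/SpQ_sim.
exists g0, (invmx g0 *m g); split; [by []| exact/SpQ_sim | | by rewrite mulKVmx].
apply: (@sim_par _ _ 1 _ B); rewrite ?oner_eq0 //.
rewrite -mulmxA; apply: (canLR (mulKmx ug0)); rewrite mulmxA.
have eU (A : 'M[rat]_(n + n)) : A *m iU q m = A *m f *m col_mx 0 1%:M.
  by rewrite -mulmxA /iU /f mul_col_mx mul1mx mul0mx.
rewrite !eU eGX -mulmxA eT !mulmxA; congr (_ *m _ *m _).
by rewrite /g0 /f mul_row_col mulmx0 addr0 mulmx1.
Qed.

(** * Integral isometries congruent to 1 modulo 4 *)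

Lemma posdef_unitmx n (Q : 'M[RR]_n) : posdef Q -> Q \in unitmx.
Proof.
move=> hQ; rewrite -row_free_unit; apply/inj_row_free => v hv.
apply/eqP; rewrite -trmx_eq0; apply/negPn/negP => /hQ.
by rewrite trmxK hv mul0mx mxE ltxx.
Qed.

Section BilinearForm.
Variables (n : nat) (Q : 'M[RR]_n).
Hypotheses (Qsym : Q^T = Q) (Qpos : posdef Q).

Definition bf (u v : 'cV[RR]_n) : RR := (u^T *m Q *m v) 0 0.

Lemma bfC u v : bf u v = bf v u.
Proof.
rewrite /bf -[in RHS](trmxK (v^T *m Q *m u)) [RHS]mxE !trmx_mul trmxK Qsym.
by rewrite mulmxA.
Qed.

Lemma bfDr u v w : bf u (v + w) = bf u v + bf u w.
Proof. by rewrite /bf mulmxDr mxE. Qed.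
Lemma bfZr c u v : bf u (c *: v) = c * bf u v.
Proof. by rewrite /bf -scalemxAr mxE. Qed.
Lemma bfDl u v w : bf (u + v) w = bf u w + bf v w.
Proof. by rewrite !(bfC _ w) bfDr. Qed.
Lemma bfZl c u v : bf (c *: u) v = c * bf u v.
Proof. by rewrite !(bfC _ v) bfZr. Qed.

Definition bfE := (bfDr, bfDl, bfZr, bfZl).

Lemma bf_eq0 v : bf v v <= 0 -> v = 0.
Proof.
by move=> h; apply/eqP/negPn/negP => /Qpos; rewrite -/(bf v v) ltNge h.
Qed.

Lemma bf_ge0 v : 0 <= bf v v.
Proof.
have [->|/Qpos/ltW //] := eqVneq v 0.
by rewrite /bf mulmx0 mxE.
Qed.

(* Cauchy-Schwarz against the vector [Q^-1 e_i], which represents the i-th coordinate. *)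
Lemma coord_bound : exists2 c : RR, 0 <= c & forall (v : 'cV_n) i, v i 0 ^+ 2 <= c * bf v v.
Proof.
have uQ := posdef_unitmx Qpos.
pose u i : 'cV[RR]_n := invmx Q *m delta_mx i 0.
have bu i (v : 'cV_n) : bf (u i) v = v i 0.
  by rewrite bfC /bf -mulmxA mulKVmx // -colE !mxE.
have bu0 i : 0 < bf (u i) (u i).
  apply: Qpos; apply/eqP => /(congr1 (mulmx Q)); rewrite mulKVmx // mulmx0.
  by move/matrixP/(_ i 0); rewrite !mxE !eqxx => /eqP; rewrite oner_eq0.
exists (\sum_i bf (u i) (u i)); first by apply: sumr_ge0 => i _; apply: ltW.
move=> v i; apply: (@le_trans _ _ (bf (u i) (u i) * bf v v)); last first.
  apply: ler_wpM2r; first exact: bf_ge0.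
  by rewrite (bigD1 i) //= lerDl sumr_ge0 // => j _; apply: ltW.
have := bf_ge0 (bf (u i) (u i) *: v + (- v i 0) *: u i).
rewrite !bfE (bfC v (u i)) !bu; move: (bu0 i); rewrite !bu; move: (u i i 0) (bf v v) (v i 0).
move=> c b x c0 h; have : 0 <= c * (c * b - x ^+ 2) by lra.
by rewrite pmulr_rge0 // subr_ge0.
Qed.

End BilinearForm.

(* Since [4 A v = M v - v], the parallelogram law shows that [A] divides the form
   by 4, so [A] is nilpotent on the lattice; a nilpotent [A] vanishes because the form
   is bounded on the orbit [v + 4 j A v]. *)
Lemma congruence_isometry_trivial n (Q : 'M[RR]_n) (A : 'M[int]_n) :
  Q^T = Q -> posdef Q ->
  let M := 1%:M + 4 *: map_mx intr A in M^T *m Q *m M = Q -> A = 0.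
Proof.
move=> Qsym Qpos M MQ; pose r p (B : 'M[int]_(n, p)) : 'M[RR]_(n, p) := map_mx intr B.
pose Ar := r _ A.
have bM u v : bf Q (M *m u) (M *m v) = bf Q u v.
  by rewrite /bf trmx_mul -[in RHS]MQ !mulmxA.
have Mv (v : 'cV_n) : M *m v = v + 4 *: (Ar *m v) by rewrite mulmxDl mul1mx -scalemxAl.
have bE := (bfE Qsym).
have bC := bfC Qsym.
have contr v : 4 * bf Q (Ar *m v) (Ar *m v) <= bf Q v v.
  have := bM v v; have := bf_ge0 Qpos (M *m v + v); rewrite !Mv !bE !(bC (Ar *m v) v).
  lra.
have AA (v : 'cV_n) : Ar *m (Ar *m v) = 0 -> Ar *m v = 0.
  move=> h; apply: (bf_eq0 Qpos).
  have := bM v v; have := bM (M *m v) (M *m v).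
  have -> : M *m (M *m v) = v + 8 *: (Ar *m v).
    by rewrite !Mv mulmxDr -scalemxAr h scaler0 addr0 -addrA -scalerDl -natrD.
  rewrite !Mv !bE !(bC (Ar *m v) v); lra.
have [c c0 hc] := coord_bound Qsym Qpos.
have small (w : 'cV[int]_n) : c * bf Q (r _ w) (r _ w) < 1 -> w = 0.
  move=> h; apply/matrixP=> i j; rewrite ord1 mxE.
  have := le_lt_trans (hc (r _ w) i) h; rewrite mxE -rmorphXn /= ltrz1.
  by move: (w i 0) => x; nia.
have nil (w : 'cV[int]_n) : exists j, iter j (mulmx Ar) (r _ w) = 0.
  pose w' j := iter j (mulmx A) w.
  have rw' j : iter j (mulmx Ar) (r _ w) = r _ (w' j).
    by elim: j => //= j ->; rewrite /r /Ar map_mxM.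
  have dec j : 4 ^+ j * bf Q (r _ (w' j)) (r _ (w' j)) <= bf Q (r _ w) (r _ w).
    elim: j => [|j IH]; first by rewrite expr0 mul1r.
    apply: le_trans IH; rewrite exprSr -mulrA; apply: ler_wpM2l; first by rewrite exprn_ge0.
    by have := contr (r _ (w' j)); rewrite /Ar /r -map_mxM.
  have [j hj] : exists j, c * bf Q (r _ w) (r _ w) < 4 ^+ j.
    exists (Num.bound (c * bf Q (r _ w) (r _ w))).
    apply: (lt_le_trans (archi_boundP _)); first by rewrite mulr_ge0 // bf_ge0.
    by rewrite -natrX ler_nat ltnW // ltn_expl.
  exists j; rewrite rw' (small (w' j)); first by rewrite /r map_mx0.
  rewrite -(ltr_pM2l (exprn_gt0 j (ltr0n RR 4))) mulr1; apply: le_lt_trans hj.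
  by rewrite mulrCA; apply: ler_wpM2l.
have nilA j (v : 'cV_n) : iter j (mulmx Ar) v = 0 -> Ar *m v = 0.
  elim: j v => [|[|j] IH] v; first by move=> /= ->; rewrite mulmx0.
    by [].
  by rewrite iterSr => /IH/AA.
apply/matrixP=> i j; rewrite mxE; have [l /nilA] := nil (delta_mx j 0).
rewrite /Ar /r -map_mxM -colE => /matrixP/(_ i 0); rewrite !mxE => /eqP.
by rewrite intr_eq0 => /eqP.
Qed.

(** * The action on Siegel space *)

Local Notation cj := (map_mx (@conjc RR)).
Local Notation rc := (map_mx (real_complex RR)).
Local Notation ci := (Complex (0 : RR) 1 : CC).

Section ComplexMatrices.

Lemma cj_cmx m p (A : 'M[rat]_(m, p)) : cj (cmx A) = cmx A.
Proof. by apply/matrixP=> i j; rewrite !mxE; apply: fmorph_rat. Qed.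

Lemma cjK m p : involutive (map_mx (@conjc RR) : 'M[CC]_(m, p) -> 'M[CC]_(m, p)).
Proof. by move=> A; apply/matrixP=> i j; rewrite !mxE conjcK. Qed.

Lemma cj_rc m p (A : 'M[RR]_(m, p)) : cj (rc A) = rc A.
Proof. by apply/matrixP=> i j; rewrite !mxE /= /conjc /= oppr0. Qed.

Lemma cmx_rc m p (A : 'M[rat]_(m, p)) : cmx A = rc (map_mx ratr A).
Proof. by apply/matrixP=> i j; rewrite !mxE fmorph_rat. Qed.

Lemma cmxM m p r (A : 'M[rat]_(m, p)) (B : 'M[rat]_(p, r)) :
  cmx (A *m B) = cmx A *m cmx B.
Proof. exact: map_mxM. Qed.

Lemma cmx1 m : cmx 1%:M = 1%:M :> 'M[CC]_m.
Proof. exact: map_mx1. Qed.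

Lemma cmx_inj m p : injective (@cmx m p).
Proof. by apply: map_mx_inj. Qed.

Lemma cjM m p r (A : 'M[CC]_(m, p)) (B : 'M[CC]_(p, r)) : cj (A *m B) = cj A *m cj B.
Proof. exact: map_mxM. Qed.

Lemma ReImE m p (A : 'M[CC]_(m, p)) :
  A = rc (map_mx (@complex.Re RR) A) + ci *: rc (Im_mx A).
Proof.
apply/matrixP=> i j; rewrite !mxE /=; case: (A i j) => a b.
by apply/eqP; rewrite eq_complex /=; apply/andP; split; apply/eqP; ring.
Qed.

Lemma cj_sub m p (A : 'M[CC]_(m, p)) : cj A - A = (- (2 * ci)) *: rc (Im_mx A).
Proof.
apply/matrixP=> i j; rewrite !mxE /=; case: (A i j) => a b.
by apply/eqP; rewrite eq_complex /=; apply/andP; split; apply/eqP; ring.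
Qed.

Lemma ci2_neq0 : - (2 * ci) != 0 :> CC.
Proof.
rewrite oppr_eq0 mulf_neq0 ?pnatr_eq0 //.
by rewrite eq_complex /= oner_eq0 andbF.
Qed.

(** For [w = a + i b] the symmetry of [Y] cancels the cross terms and leaves [Y(a, a) + Y(b, b)]. *)
Lemma herm_posdef n (Y : 'M[RR]_n) (w : 'cV[CC]_n) : posdef Y -> Y^T = Y -> w != 0 ->
  0 < ((cj w)^T *m rc Y *m w) 0 0.
Proof.
move=> Yp Ys w0; pose a := map_mx (@complex.Re RR) w; pose b := Im_mx w.
have ew : w = rc a + ci *: rc b by exact: ReImE.
have ec : cj w = rc a - ci *: rc b.
  apply/matrixP=> i j; rewrite !mxE; case: (w i j) => x y.
  by apply/eqP; rewrite eq_complex /=; apply/andP; split; apply/eqP; ring.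
have eb : ((cj w)^T *m rc Y *m w) 0 0 = real_complex RR (bf Y a a + bf Y b b).
  have rcbf u v : ((rc u)^T *m rc Y *m rc v) 0 0 = real_complex RR (bf Y u v).
    by rewrite map_trmx -!map_mxM mxE.
  rewrite ec ew linearB /= linearZ /= mulmxBl -!scalemxAl mulmxBl !mulmxDr -!scalemxAl -!scalemxAr.
  have mxD (A B : 'M[CC]_1) : (A + B) 0 0 = A 0 0 + B 0 0 by rewrite mxE.
  have mxN (A : 'M[CC]_1) : (- A) 0 0 = - A 0 0 by rewrite mxE.
  have mxZ c (A : 'M[CC]_1) : (c *: A) 0 0 = c * A 0 0 by rewrite mxE.
  rewrite !(mxD, mxN, mxZ) !rcbf (bfC Ys b a).
  by apply/eqP; rewrite eq_complex /=; apply/andP; split; apply/eqP; ring.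
rewrite eb ltcR.
have [a0|a0] := eqVneq a 0; last by apply: ltr_wpDr; [exact: bf_ge0 | exact: Yp].
have [b0|b0] := eqVneq b 0; last by apply: ltr_wpDl; [exact: bf_ge0 | exact: Yp].
by move: w0; rewrite ew a0 b0 !map_mx0 scaler0 addr0 eqxx.
Qed.

End ComplexMatrices.

Section SiegelAction.
Variable n : nat.
Implicit Types (Z : 'M[CC]_n) (g : 'M[rat]_(n + n)).

(** Its columns span the subspace representing [Z]; the action on [Z] becomes multiplication by [g],
    up to an invertible factor on the right. *)
Definition frame Z : 'M[CC]_(n + n, n) := col_mx Z 1%:M.

Lemma frame_J Z Z' : (frame Z)^T *m cmx (Jmx n) *m frame Z' = Z^T - Z'.
Proof.
rewrite /frame /cmx /Jmx map_block_mx tr_col_mx trmx1 mul_row_block.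
rewrite map_mx0 map_mxN map_mx1 !mulmx0 !mulmxN !mulmx1 add0r addr0 mul_row_col.
by rewrite mulmx1 mulNmx mul1mx addrC.
Qed.

Lemma cj_frame Z : cj (frame Z) = frame (cj Z).
Proof. by rewrite /frame map_col_mx map_mx1. Qed.

Lemma frame_herm Z : Z^T = Z ->
  (cj (frame Z))^T *m cmx (Jmx n) *m frame Z = (- (2 * ci)) *: rc (Im_mx Z).
Proof. by move=> Zs; rewrite cj_frame frame_J map_trmx Zs cj_sub. Qed.

Lemma cmx_frame g Z : cmx g *m frame Z =
  col_mx (cmx (ulsubmx g) *m Z + cmx (ursubmx g)) (cmx (dlsubmx g) *m Z + cmx (drsubmx g)).
Proof.
rewrite -[in LHS](submxK g) /cmx map_block_mx /frame mul_block_col.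
by rewrite !mulmx1.
Qed.

Lemma frameM p Z (K : 'M[CC]_(n, p)) : frame Z *m K = col_mx (Z *m K) K.
Proof. by rewrite /frame mul_col_mx mul1mx. Qed.

Lemma mactP g Z Z' K : K \in unitmx -> cmx g *m frame Z = frame Z' *m K -> mact g Z = Z'.
Proof.
move=> uK; rewrite cmx_frame frameM /mact => /eq_col_mx[-> ->].
by rewrite mulmxK.
Qed.

Lemma col_herm (P K : 'M[CC]_n) : (cj (col_mx P K))^T *m cmx (Jmx n) *m col_mx P K
  = (cj P)^T *m K - (cj K)^T *m P.
Proof.
rewrite map_col_mx tr_col_mx; move: (cj P)^T (cj K)^T => A B.
rewrite /Jmx /cmx map_block_mx map_mx0 map_mxN map_mx1 mul_row_block.
by rewrite !mulmx0 !mulmxN !mulmx1 add0r addr0 mul_row_col mulNmx addrC.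
Qed.

(** The Hermitian form given by [J] is invariant under [g] and equals [- 2 i Im Z] on the frame. A
    vector killed by [K = C Z + D] would be isotropic for it, and [K] carries [Im (g Z)] to
    [Im Z]. *)
Lemma SpQ_frame g Z : SpQ g -> hn Z -> hn (mact g Z) /\
  exists2 K, K \in unitmx & cmx g *m frame Z = frame (mact g Z) *m K.
Proof.
move=> hg [Zs Zp].
have [P [K [em e]]] : exists P K, mact g Z = P *m invmx K /\ cmx g *m frame Z = col_mx P K.
  by eexists; eexists; split; [reflexivity | exact: cmx_frame].
have Ys : (Im_mx Z)^T = Im_mx Z by rewrite map_trmx Zs.
have herm (X X' : 'M[CC]_(n + n, n)) :
    (cmx g *m X)^T *m cmx (Jmx n) *m (cmx g *m X') = X^T *m cmx (Jmx n) *m X'.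
  by rewrite trmx_mul -{2}hg !cmxM {2}/cmx map_trmx !mulmxA.
have cme : cj (cmx g *m frame Z) = cmx g *m frame (cj Z) by rewrite cjM cj_cmx cj_frame.
have posK (w : 'cV[CC]_n) : K *m w = 0 -> w = 0.
  move=> Kw; apply/eqP/negPn/negP => /(herm_posdef Zp Ys).
  suff -> : (cj w)^T *m rc (Im_mx Z) *m w = 0 by rewrite mxE ltxx.
  apply: (scalerI ci2_neq0); rewrite scaler0 scalemxAl scalemxAr -frame_herm //.
  rewrite cj_frame -herm -cme e.
  rewrite col_herm.
  rewrite mulmxBr mulmxBl -!mulmxA Kw !mulmx0 sub0r [X in - X]mulmxA.
  by rewrite -trmx_mul -cjM Kw map_mx0 trmx0 mul0mx oppr0.
have uK : K \in unitmx.
  rewrite -unitmx_tr -row_free_unit; apply/inj_row_free => v hv.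
  by apply: trmx_inj; rewrite trmx0; apply: posK; rewrite -[K]trmxK -trmx_mul hv trmx0.
have e' : cmx g *m frame Z = frame (mact g Z) *m K by rewrite e frameM em mulmxKV.
split; last by exists K.
have fr : frame (mact g Z) = cmx g *m frame Z *m invmx K by rewrite e' mulmxK.
have Z's : (mact g Z)^T = mact g Z.
  apply/eqP; rewrite -subr_eq0 -frame_J fr trmx_mul -!mulmxA (mulmxA _ _ (invmx K)).
  rewrite (mulmxA (cmx (Jmx n))) (mulmxA (cmx g *m _)^T) (mulmxA (cmx g *m _)^T) herm.
  by rewrite frame_J Zs subrr mul0mx mulmx0.
split=> // v v0.
pose w := invmx K *m rc v.
have w0 : w != 0.
  apply/eqP => /(congr1 (mulmx K)); rewrite mulKVmx // mulmx0 => /eqP.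
  by rewrite map_mx_eq0 (negPf v0).
have := herm_posdef Zp Ys w0; rewrite -ltcR; congr (_ < _).
suff -> : (cj w)^T *m rc (Im_mx Z) *m w = rc (v^T *m Im_mx (mact g Z) *m v) by rewrite mxE.
apply: (scalerI ci2_neq0); rewrite [rc (_ *m v)]map_mxM [rc (v^T *m _)]map_mxM -map_trmx.
rewrite [LHS]scalemxAl [RHS]scalemxAl ![_ *: (_ *m _)]scalemxAr -!frame_herm //.
by rewrite [in LHS]cj_frame -herm -cme fr /w !cjM cj_rc !trmx_mul cj_cmx !mulmxA.
Qed.

Lemma mactM g h Z : SpQ g -> SpQ h -> hn Z -> mact (g *m h) Z = mact g (mact h Z).
Proof.
move=> hg hh hZ; have [hZ' [K uK eK]] := SpQ_frame hh hZ.
have [_ [L uL eL]] := SpQ_frame hg hZ'.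
apply: (@mactP _ _ _ (L *m K)); first by rewrite unitmx_mul uL.
by rewrite cmxM -mulmxA eK mulmxA eL mulmxA.
Qed.

Definition Emq : 'M[rat]_(n + n) := block_mx 1%:M 0 0 (- 1%:M).

Lemma cmx_Emq : cmx Emq = Emx n.
Proof. by rewrite /cmx /Emq /Emx map_block_mx !map_mx0 map_mxN !map_mx1. Qed.

Lemma EmqK : Emq *m Emq = 1%:M.
Proof.
rewrite /Emq mulmx_block !mulmx0 !mul0mx !mulmx1 mulmxN mulNmx mulmx1 opprK.
by rewrite !addr0 !add0r -scalar_mx_block.
Qed.

Lemma Emq_sim : sim (- 1) Emq.
Proof.
rewrite /sim /Emq /Jmx tr_block_mx !trmx0 linearN /= trmx1 !mulmx_block.
rewrite !(mulmx0, mul0mx, mulmxN, mulNmx, mulmx1, addr0, add0r, opprK, oppr0).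
by rewrite scaleN1r opp_block_mx oppr0 opprK.
Qed.

Lemma frame_tauZ Z : frame (tauZ Z) = - (cmx Emq *m cj (frame Z)).
Proof.
rewrite cj_frame /frame cmx_Emq /Emx mul_block_col !mul0mx mul1mx mulNmx mul1mx.
by rewrite addr0 add0r opp_col_mx opprK.
Qed.

(** [E g E] is the matrix [tau g], and the formula is the complex conjugate of the frame identity
    for [g]. *)
Lemma mact_tau g Z : SpQ g -> hn Z -> mact (Emq *m g *m Emq) (tauZ Z) = tauZ (mact g Z).
Proof.
move=> hg hZ; have [_ [K uK eK]] := SpQ_frame hg hZ.
apply: (@mactP _ _ _ (cj K)); first by rewrite map_unitmx.
rewrite !frame_tauZ !cmxM mulmxN mulNmx -!mulmxA (mulmxA (cmx Emq) (cmx Emq)) -cmxM EmqK.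
by rewrite cmx1 mul1mx -cjM -eK cjM cj_cmx.
Qed.

End SiegelAction.

(** * Positive definite matrices and invariant forms *)

Lemma posdef_invmx n (Y : 'M[RR]_n) : Y^T = Y -> posdef Y -> posdef (invmx Y).
Proof.
move=> Ys Yp v v0; have uY := posdef_unitmx Yp.
have w0 : invmx Y *m v != 0.
  by apply/eqP => /(congr1 (mulmx Y)) /eqP; rewrite mulKVmx // mulmx0 (negPf v0).
have := Yp _ w0; rewrite trmx_mul trmx_inv Ys -!mulmxA mulKVmx //.
Qed.

Lemma posdef_congr n (Q B : 'M[RR]_n) : B \in unitmx -> posdef Q -> posdef (B *m Q *m B^T).
Proof.
move=> uB hQ v v0; have w0 : B^T *m v != 0.
  apply/eqP => /(congr1 (mulmx (invmx B^T))) /eqP.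
  by rewrite mulKmx ?unitmx_tr // mulmx0 (negPf v0).
by have := hQ _ w0; rewrite trmx_mul trmxK !mulmxA.
Qed.

Lemma posdef_block_diag p r (A : 'M[RR]_p) (B : 'M[RR]_r) :
  posdef A -> posdef B -> posdef (block_mx A 0 0 B).
Proof.
move=> hA hB v v0; rewrite -[v]vsubmxK in v0 *.
rewrite tr_col_mx mul_row_block !mulmx0 addr0 add0r mul_row_col mxE.
have ge0 t (C : 'M[RR]_t) (u : 'cV[RR]_t) : posdef C -> 0 <= (u^T *m C *m u) 0 0.
  move=> hC; have [->|/hC/ltW //] := eqVneq u 0.
  by rewrite mulmx0 mxE.
have [u0|u0] := eqVneq (usubmx v) 0; last by apply: ltr_wpDr; [exact: ge0 | exact: hA].
have [d0|d0] := eqVneq (dsubmx v) 0; last by apply: ltr_wpDl; [exact: ge0 | exact: hB].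
by move: v0; rewrite u0 d0 col_mx0 eqxx.
Qed.

Lemma posdef_scalar_gram n (a b : RR) (s : 'M[RR]_n) : 0 < a -> 0 <= b ->
  posdef (a%:M + b *: (s *m s^T)).
Proof.
move=> a0 b0 v v0.
have sq p (u : 'cV[RR]_p) : (u^T *m u) 0 0 = \sum_i u i 0 ^+ 2.
  by rewrite mxE; apply: eq_bigr => i _; rewrite mxE expr2.
have -> : v^T *m (a%:M + b *: (s *m s^T)) *m v
    = a *: (v^T *m v) + b *: ((s^T *m v)^T *m (s^T *m v)).
  rewrite mulmxDr mulmxDl mul_mx_scalar -!scalemxAl -scalemxAr -scalemxAl trmx_mul trmxK.
  by rewrite !mulmxA.
rewrite mxE; apply: ltr_wpDr.
  by rewrite mxE mulr_ge0 // sq sumr_ge0 // => i _; exact: sqr_ge0.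
rewrite mxE mulr_gt0 // sq lt_neqAle sumr_ge0 ?andbT; last by move=> i _; exact: sqr_ge0.
apply: contra v0 => /eqP/esym/psumr_eq0P h; apply/eqP/matrixP => i j.
by rewrite ord1 mxE; apply/eqP; rewrite -sqrf_eq0 h // => l _; exact: sqr_ge0.
Qed.

Local Notation Re_mx := (map_mx (@complex.Re RR)).

Lemma Re_rcM m p r (A : 'M[RR]_(m, p)) (B : 'M[CC]_(p, r)) :
  Re_mx (rc A *m B) = A *m Re_mx B.
Proof.
apply/matrixP=> i j; rewrite !mxE raddf_sum; apply: eq_bigr => l _; rewrite !mxE.
by case: (B l j) => x y /=; rewrite mul0r subr0.
Qed.

Lemma Re_Mrc m p r (A : 'M[CC]_(m, p)) (B : 'M[RR]_(p, r)) :
  Re_mx (A *m rc B) = Re_mx A *m B.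
Proof. by apply: trmx_inj; rewrite trmx_mul !map_trmx trmx_mul map_trmx Re_rcM. Qed.

Lemma Re_cj m p (A : 'M[CC]_(m, p)) : Re_mx (cj A) = Re_mx A.
Proof. by apply/matrixP=> i j; rewrite !mxE; case: (A i j). Qed.

(* The form is the real part of [H = F Y^-1 F^*] for the frame [F = [z; 1]] and
   [Y = Im z]; an antisymplectic [S] exchanging the frame with its conjugate sends [H]
   to its conjugate. *)
Lemma siegel_form q (S : 'M[rat]_(q + q)) (z K : 'M[CC]_q) :
  sim (- 1) S -> hn z -> cmx S *m frame z = cj (frame z) *m K ->
  exists Q : 'M[RR]_(q + q),
    [/\ Q^T = Q, posdef Q & map_mx ratr S *m Q *m (map_mx ratr S)^T = Q].
Proof.
move=> hS [zs zp] eK; set F := frame z in eK.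
pose Y := Im_mx z; have Ys : Y^T = Y by rewrite map_trmx zs.
have uY := posdef_unitmx zp; rewrite -/Y in uY zp.
pose Yi := invmx Y; have Yis : Yi^T = Yi by rewrite /Yi trmx_inv Ys.
have ucY : rc Y \in unitmx by rewrite map_unitmx.
have fh : (cj F)^T *m cmx (Jmx q) *m F = (- (2 * ci)) *: rc Y by rewrite /F frame_herm.
have fh' : F^T *m cmx (Jmx q) *m cj F = - ((- (2 * ci)) *: rc Y).
  by rewrite /F cj_frame frame_J zs -cj_sub opprB.
have cK : cmx S *m cj F = F *m cj K by rewrite -{1}cj_cmx -cjM eK cjM cjK.
(* The sign from [sim (- 1)] cancels the one from exchanging the frame with its conjugate, so [K] is
   unitary for [Y]. *)
have KYK : (cj K)^T *m rc Y *m K = rc Y.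
  apply: (scalerI ci2_neq0); rewrite scalemxAl scalemxAr; apply: oppr_inj.
  rewrite -mulNmx -mulmxN -fh'.
  have -> : (cj K)^T *m (F^T *m cmx (Jmx q) *m cj F) *m K
      = (cmx S *m cj F)^T *m cmx (Jmx q) *m (cmx S *m F).
    by rewrite eK cK trmx_mul !mulmxA.
  have -> : (cmx S *m cj F)^T *m cmx (Jmx q) *m (cmx S *m F)
      = (cj F)^T *m ((cmx S)^T *m cmx (Jmx q) *m cmx S) *m F.
    by rewrite trmx_mul !mulmxA.
  have -> : (cmx S)^T *m cmx (Jmx q) *m cmx S = - cmx (Jmx q).
    by rewrite /cmx map_trmx -!map_mxM hS scaleN1r map_mxN.
  by rewrite mulmxN mulNmx fh.
have KYi : K *m rc Yi *m (cj K)^T = rc Yi.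
  have : rc Yi *m (cj K)^T *m rc Y *m K = 1%:M.
    by rewrite -!mulmxA (mulmxA (cj K)^T) KYK -map_mxM mulVmx // map_mx1.
  move/mulmx1C; rewrite !mulmxA => h.
  by rewrite -[LHS](mulmxK ucY) h mul1mx -map_invmx.
pose H := F *m rc Yi *m (cj F)^T.
have HT : H^T = cj H.
  by rewrite /H !trmx_mul trmxK !map_trmx Yis !cjM cj_rc -!map_trmx cjK mulmxA.
exists (Re_mx H); split.
- by rewrite map_trmx HT Re_cj.
- move=> v v0; pose u := (cj F)^T *m rc v.
  (* For real [v], subtracting the conjugate of the equation [u = 0] leaves [Y] times the upper half
     of [v] equal to 0; then the lower half vanishes too. *)
  have u0 : u != 0.
    apply/eqP; rewrite /u /F cj_frame /frame tr_col_mx trmx1 => u0.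
    move: v0; rewrite -[v]vsubmxK map_col_mx mul_row_col mul1mx in u0 *.
    have e1 : usubmx v = 0.
      have : rc Y *m rc (usubmx v) = 0.
        apply: (scalerI ci2_neq0); rewrite scaler0 scalemxAl -cj_sub mulmxBl.
        move: u0; rewrite map_trmx zs => u0.
        have := congr1 (fun A => cj A) u0; rewrite map_mxD cjM cjK !cj_rc map_mx0 => u0'.
        apply/eqP; rewrite subr_eq0; apply/eqP.
        by apply: (addIr (rc (dsubmx v))); rewrite u0 u0'.
      move/(congr1 (mulmx (invmx (rc Y)))); rewrite mulKmx // mulmx0 => /eqP.
      by rewrite map_mx_eq0 => /eqP.
    move: u0; rewrite e1 map_mx0 mulmx0 add0r => /eqP; rewrite map_mx_eq0 => /eqP ->.
    by rewrite col_mx0 eqxx.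
  have := herm_posdef (posdef_invmx Ys zp) Yis u0; rewrite -/Yi.
  have -> : (cj u)^T *m rc Yi *m u = rc v^T *m H *m rc v.
    by rewrite /u /H cjM cj_rc trmx_mul -!map_trmx cjK trmxK !mulmxA.
  rewrite -Re_rcM -Re_Mrc [X in _ -> _ < X]mxE.
  by case: (_ 0 0) => x y; rewrite ltcE /= => /andP[].
- have -> : map_mx ratr S *m Re_mx H *m (map_mx ratr S)^T
      = Re_mx (cmx S *m H *m (cmx S)^T).
    by rewrite cmx_rc [(rc _)^T]map_trmx Re_Mrc Re_rcM.
  rewrite -[in RHS](Re_cj H); congr (map_mx _ _).
  have -> : cmx S *m H *m (cmx S)^T = (cmx S *m F) *m rc Yi *m (cmx S *m cj F)^T.
    by rewrite trmx_mul !mulmxA.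
  rewrite eK cK trmx_mul.
  have -> : cj F *m K *m rc Yi *m ((cj K)^T *m F^T)
      = cj F *m (K *m rc Yi *m (cj K)^T) *m F^T by rewrite !mulmxA.
  by rewrite KYi /H !cjM cj_rc -map_trmx cjK.
Qed.

(** [S^2 = 1 + 4 (p^2 - p)], so the transpose of [S^2] is an integral isometry of [Q] congruent to 1
    modulo 4, hence trivial. *)
Lemma isometry_involution n (S p : 'M[rat]_n) (Q : 'M[RR]_n) :
  integral_mx p -> S = 1%:M - 2 *: p -> Q^T = Q -> posdef Q ->
  map_mx ratr S *m Q *m (map_mx ratr S)^T = Q -> S *m S = 1%:M.
Proof.
move=> ip eS Qs Qp SQ.
have /integral_mxP[A eA] : integral_mx (p *m p - p)^T.
  by apply: integral_mx_tr; apply: integral_mxB => //; apply: integral_mxM.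
have SS_ : (S *m S)^T = 1%:M + 4 *: map_mx intr A.
  rewrite -eA -[1%:M]trmx1 -linearZ -linearD /=; congr trmx.
  rewrite eS mulmxBr !mulmxBl mulmx1 mul1mx mulmx1 -scalemxAr -scalemxAl.
  by move: (p *m p) => P; apply/matrixP=> i j; rewrite !mxE; ring.
have A0 : A = 0.
  apply: (congruence_isometry_trivial Qs Qp).
  have -> : 1%:M + 4 *: map_mx intr A = map_mx ratr (S *m S)^T :> 'M[RR]_n.
    rewrite SS_ map_mxD map_mx1 map_mxZ /= ratr_nat; congr (_ + _ *: _).
    by apply/matrixP=> i j; rewrite !mxE ratr_int.
  rewrite -map_trmx trmxK map_mxM trmx_mul !mulmxA.
  by rewrite -(mulmxA _ _ Q) -(mulmxA _ (_ *m Q)) SQ.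
by apply: trmx_inj; rewrite SS_ A0 map_mx0 scaler0 addr0 trmx1.
Qed.

(** * Fixed points on boundary components *)

Lemma entE (T : nmodType) m p (A : 'M[T]_(m, p)) (i : 'I_m) (j : 'I_p) : ent A i j = A i j.
Proof.
rewrite /ent; have -> : insub (nat_of_ord i) = Some i by exact: valK.
by have -> : insub (nat_of_ord j) = Some j by exact: valK.
Qed.

Section BoundaryPoints.
Variables q m : nat.
Local Notation n := (q + m)%N.

(** The general vector of [Wq z], written with the inclusions of [S] and [U] in place of index
    arithmetic. *)
Definition bvec (z : 'M[CC]_q) (a : 'cV[CC]_q) (b : 'cV[CC]_m) : 'cV[CC]_(n + n) :=
  cmx (iS q m) *m (frame z *m a) + cmx (iU q m) *m b.

Lemma bvecE z a b : bvec z a b = col_mx (col_mx (z *m a) b) (col_mx a 0).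
Proof.
rewrite /bvec /iS /iU /cmx map_block_mx !map_col_mx !map_mx0 !map_mx1 frameM.
rewrite mul_block_col !mul_col_mx !mul0mx !mul1mx add_col_mx addr0 add0r.
by rewrite !add_col_mx !addr0 !add0r.
Qed.

Lemma bvec_coord z a (b : 'cV_m) (b' : 'cV[CC]_(n - q)) :
  (forall j : 'I_m, ent b' j 0 = b j 0) -> forall i : 'I_(n + n),
  bvec z a b i 0 = (let k := nat_of_ord i in
               if (k < q)%nat then ent (z *m a) k 0
               else if (k < n)%nat then ent b' (subn k q) 0
               else if (k < n + q)%nat then ent a (subn k n) 0
               else 0).
Proof.
move=> hb i; rewrite bvecE /=.
case: (split_ordP i) => i1 ->; case: (split_ordP i1) => i2 ->;
  rewrite ?col_mxEu ?col_mxEd ?col_mxEu /=.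
- exact: (esym (entE _ _ (0 : 'I_1))).
- by rewrite -hb (addKn q i2).
- rewrite ltnNge -addnA leq_addr /= addnA ltn_add2l ltn_ord addKn.
  exact: (esym (entE _ _ (0 : 'I_1))).
- rewrite ltnNge -addnA leq_addr /= addnA ltn_add2l ltnNge leq_addr /=.
  by rewrite mxE.
Qed.

Lemma Wq_iff (z : 'M[CC]_q) v : @Wq n q z v <-> exists a b, v = bvec z a b.
Proof.
split=> [[a [b' hv]]|[a [b ->]]].
  exists a, (\col_j ent b' j 0); apply/matrixP=> i j; rewrite ord1 hv.
  by rewrite (@bvec_coord _ _ _ b') // => l; rewrite mxE.
(* This equality is not definitional, so [b] has to be cast along it. *)
have e : (n - q)%N = m by rewrite addKn.
exists a, (castmx (esym e, erefl 1%N) b); apply: bvec_coord => j.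
rewrite -[nat_of_ord j]/(nat_of_ord (cast_ord (esym e) j)).
by rewrite (entE _ _ (0 : 'I_1)) castmxE cast_ordK cast_ord_id.
Qed.

Section Fixed.
Variables (sg : 'M[rat]_(n + n)) (z : 'M[CC]_q).
Hypotheses (sg_sim : sim (- 1) sg) (hz : hn z).

Lemma cmx_iSb a b : cmx (iS q m)^T *m bvec z a b = frame z *m a.
Proof. by rewrite mulmxDr !mulmxA -!cmxM !ii cmx1 /cmx map_mx0 !mul0mx mul1mx addr0. Qed.

Lemma cmx_iVb a b : cmx (iV q m)^T *m bvec z a b = 0.
Proof. by rewrite mulmxDr !mulmxA -!cmxM !ii /cmx !map_mx0 !mul0mx addr0. Qed.

Lemma col_ext p r (A B : 'M[CC]_(p, r)) :
  (forall j, A *m delta_mx j 0 = B *m (delta_mx j 0 : 'cV_r)) -> A = B.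
Proof.
move=> h; apply/matrixP=> i j; have := h j; rewrite -!colE => /matrixP/(_ i 0).
by rewrite !mxE.
Qed.

(** The lower half says that [a] is real; the upper half then gives [Im z a = 0]. *)
Lemma real_frame_eq0 (a : 'cV[CC]_q) : cj (frame z *m a) = frame z *m a -> a = 0.
Proof.
have [zs zp] := hz; rewrite cjM cj_frame !frameM => /eq_col_mx[e1 e2].
have : rc (Im_mx z) *m a = 0.
  apply: (scalerI ci2_neq0); rewrite scaler0 scalemxAl -cj_sub mulmxBl -e1 e2 subrr //.
move/(congr1 (mulmx (invmx (rc (Im_mx z))))); rewrite mulmx0 mulKmx //.
by rewrite map_unitmx posdef_unitmx.
Qed.

(** The real vectors of [Wq z] are those of [U], and [w -> conj (sg w)] maps real vectors to real
    ones; so [sg] stabilises [U], and being a similitude it is parabolic. *)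
Lemma fixed_par : (forall w, @Wq n q z w -> @Wq n q z (cj (cmx sg *m w))) ->
  par sg /\ exists K, cmx (SS sg) *m frame z = cj (frame z) *m K.
Proof.
move=> fx.
have colU j : exists a b, cmx (sg *m iU q m) *m delta_mx j 0 = bvec z a b.
  have /fx/Wq_iff[a [b e]] : @Wq n q z (cmx (iU q m) *m delta_mx j 0).
    by apply/Wq_iff; exists 0, (delta_mx j 0); rewrite /bvec !mulmx0 add0r.
  exists a, b; rewrite -e !cjM !cj_cmx cmxM mulmxA; congr (_ *m _).
  by rewrite map_delta_mx.
have iSU0 : (iS q m)^T *m sg *m iU q m = 0.
  apply: cmx_inj; apply: col_ext => j; have [a [b e]] := colU j.
  have e' : cmx ((iS q m)^T *m sg *m iU q m) *m delta_mx j 0 = frame z *m a.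
    by rewrite -(mulmxA _ sg) cmxM -mulmxA e cmx_iSb.
  rewrite e' (@real_frame_eq0 a) ?mulmx0 ?/cmx ?map_mx0 ?mul0mx //.
  by rewrite -e' cjM cj_cmx map_delta_mx.
have iVU0 : (iV q m)^T *m sg *m iU q m = 0.
  apply: cmx_inj; apply: col_ext => j; have [a [b e]] := colU j.
  by rewrite -(mulmxA _ sg) cmxM -mulmxA e cmx_iVb /cmx map_mx0 mul0mx.
have pr : par sg.
  apply: (@sim_par q m (- 1) sg (UU sg)) => //.
  by apply: mx_ext; rewrite !mulmxA !ii ?mul1mx ?mul0mx.
(* [K] is read off the lower half, where the conjugate frame is the identity. *)
split=> //; exists (row_mx 0 1%:M *m (cmx (SS sg) *m frame z)).
apply: col_ext => j.
have /fx/Wq_iff[a [b e]] : @Wq n q z (cmx (iS q m) *m (frame z *m delta_mx j 0)).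
  by apply/Wq_iff; exists (delta_mx j 0), 0; rewrite /bvec !mulmx0 addr0.
have e1 : cj (cmx (SS sg) *m frame z *m delta_mx j 0) = frame z *m a.
  by rewrite -(cmx_iSb a b) -e -[in RHS]cj_cmx -cjM !mulmxA -!cmxM.
have e2 : cmx (SS sg) *m frame z *m delta_mx j 0 = cj (frame z) *m cj a.
  by rewrite -cjM -e1 cjK.
rewrite -!mulmxA in e2 *; rewrite e2; congr (_ *m _).
by rewrite cj_frame frameM mul_row_col mul0mx mul1mx add0r.
Qed.

Lemma fixed_fwd K : par sg -> cmx (SS sg) *m frame z = cj (frame z) *m K ->
  forall w, @Wq n q z w -> @Wq n q z (cj (cmx sg *m w)).
Proof.
move=> pr eK w /Wq_iff[a [b ->]]; apply/Wq_iff.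
exists (cj (K *m a)),
  (cj (cmx ((iU q m)^T *m sg *m iS q m) *m (frame z *m a) + cmx (UU sg) *m b)).
have cb a' b' : cj (bvec z (cj a') (cj b')) =
    cmx (iS q m) *m (cj (frame z) *m a') + cmx (iU q m) *m b'.
  by rewrite /bvec map_mxD !cjM !cj_cmx !cjK.
rewrite -[RHS]cjK cb; congr map_mx; rewrite /bvec !mulmxDr addrA; congr (_ + _).
  have e : cmx sg *m cmx (iS q m) = cmx (iS q m) *m cmx (SS sg)
      + cmx (iU q m) *m cmx ((iU q m)^T *m sg *m iS q m).
    by rewrite -!cmxM (par_iS pr) /cmx map_mxD.
  by rewrite mulmxA e mulmxDl -!mulmxA (mulmxA (cmx (SS sg))) eK !mulmxA.
by rewrite !mulmxA -!cmxM (par_iU pr).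
Qed.

End Fixed.
End BoundaryPoints.

(** * Fixed points of [gam] through the antisymplectic matrix [E gam] *)

Lemma gact_iff n (g : 'M[rat]_(n + n)) (x : pt n) v : g \in unitmx ->
  gact g x v <-> x (cmx (invmx g) *m v).
Proof.
move=> ug; split=> [[w [hw ->]]|h].
  by rewrite mulmxA -cmxM mulVmx // cmx1 mul1mx.
by exists (cmx (invmx g) *m v); split=> //; rewrite mulmxA -cmxM mulmxV // cmx1 mul1mx.
Qed.

(** The matrix [sg = E gam] seen from the standard component: [g] carries [F_q] to [F]. *)
Definition refl_of n (g gam : 'M[rat]_(n + n)) : 'M[rat]_(n + n) :=
  invmx g *m (Emq n *m gam) *m g.

Lemma refl_sim n (g gam : 'M[rat]_(n + n)) : SpQ g -> SpQ gam -> sim (- 1) (refl_of g gam).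
Proof.
move=> /SpQ_sim hg /SpQ_sim hgam; rewrite -[- 1]mulr1; apply: simM => //.
rewrite -[- 1]mul1r; apply: simM; first by rewrite -[1]invr1; apply: sim_inv.
by rewrite -[- 1]mulr1; apply: simM => //; exact: Emq_sim.
Qed.

(** Evaluating [tau x = gam x] at [v = gam g w] turns it into invariance of [W] under the antilinear
    map [w -> conj (sg w)]. *)
Lemma fix_iff n (g gam : 'M[rat]_(n + n)) (x W : pt n) : SpQ g -> SpQ gam ->
  pt_eq x (gact g W) ->
  pt_eq (tau_pt x) (gact gam x) <->
  (forall w, W w <-> W (cj (cmx (refl_of g gam) *m w))).
Proof.
move=> hg hgam xW.
have ug : g \in unitmx by apply: (@sim_unitmx _ 1) => //; apply/SpQ_sim.
have ugam : gam \in unitmx by apply: (@sim_unitmx _ 1) => //; apply/SpQ_sim.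
have xE v : x v <-> W (cmx (invmx g) *m v) by rewrite -gact_iff //; apply: xW.
have [gi egi] : exists gi, gi = invmx g *m invmx gam by eexists.
have gi1 : gi *m (gam *m g) = 1%:M by rewrite egi mulmxA mulmxKV // mulVmx.
have gi2 := mulmx1C gi1.
have gamE v : gact gam x v <-> W (cmx gi *m v).
  by rewrite gact_iff // xE mulmxA -cmxM egi.
have tauE v : tau_pt x v <->
    W (cj (cmx (refl_of g gam) *m (cmx (gi) *m v))).
  rewrite /tau_pt xE.
  suff -> : cmx (invmx g) *m cj (Emx n *m v) =
    cj (cmx (refl_of g gam) *m (cmx (gi) *m v)) by [].
  rewrite -cmx_Emq -{1}cj_cmx -cjM !mulmxA -!cmxM /refl_of; congr (cj (cmx _ *m _)).
  by rewrite -!mulmxA (mulmxA gam) gi2 mulmx1.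
split=> [h w|h v].
  have := h (cmx (gam *m g) *m w); rewrite tauE gamE !(mulmxA _ _ w) -!cmxM gi1.
  by rewrite cmx1 mul1mx mulmx1 => h'; apply: iff_sym.
by rewrite tauE gamE; apply: iff_sym.
Qed.

(** * Approximation by fixed points in the interior *)

Section Unipotent.
Variables q m : nat.
Local Notation n := (q + m)%N.

Lemma unipotent_block (v : 'M[rat]_(n + n)) :
  par v -> UU v = 1%:M -> SS v = 1%:M -> VV v = 1%:M ->
  exists (b1 b2 : 'M[rat]_(m, q)) (a1 a2 : 'M[rat]_(q, m)) (k : 'M[rat]_m),
  v = block_mx (block_mx 1%:M 0 b1 1%:M) (block_mx 0 a1 b2 k)
               0 (block_mx 1%:M a2 0 1%:M).
Proof.
move=> pv hU hS hV.
have [b1 [b2 eb]] : exists b1 b2, (iU q m)^T *m v *m iS q m = row_mx b1 b2.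
  by exists (lsubmx ((iU q m)^T *m v *m iS q m)), (rsubmx ((iU q m)^T *m v *m iS q m));
    rewrite hsubmxK.
have [a1 [a2 ea]] : exists a1 a2, (iS q m)^T *m v *m iV q m = col_mx a1 a2.
  by exists (usubmx ((iS q m)^T *m v *m iV q m)), (dsubmx ((iS q m)^T *m v *m iV q m));
    rewrite vsubmxK.
pose k := (iU q m)^T *m v *m iV q m; exists b1, b2, a1, a2, k.
have eS : v *m iS q m = iS q m + iU q m *m row_mx b1 b2.
  by rewrite (par_iS pv) hS mulmx1 eb.
have eU : v *m iU q m = iU q m by rewrite (par_iU pv) hU mulmx1.
have eV : v *m iV q m = iV q m + iU q m *m k + iS q m *m col_mx a1 a2.
  rewrite -ea; apply: mx_ext; rewrite !mulmxDr !mulmxA !ii ?mul1mx ?mul0mx ?addr0 ?add0r //.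
clearbody k.
have eb' : col_mx 0 (row_mx b1 b2) = row_mx (col_mx 0 b1) (col_mx 0 b2) :> 'M[rat]_(n, _).
  by rewrite -[X in col_mx X _]row_mx0 -block_mxEh.
apply: mx_extr.
- rewrite eU /iU mul_block_col !mul_block_col.
  by rewrite !(mul0mx, mulmx0, mulmx1, mul1mx, add0r, addr0).
- rewrite eS /iS /iU mulmx_block !mul_block_col !mul_col_mx.
  rewrite !(mul0mx, mulmx0, mulmx1, mul1mx, add0r, addr0, col_mx0) eb' /block_mx.
  by rewrite add_col_mx add_row_mx add_col_mx !(add0r, addr0).
- rewrite eV /iV /iU /iS mul_block_col !mul_block_col !mul_col_mx.
  rewrite !(mul0mx, mulmx0, mulmx1, mul1mx, add0r, addr0, col_mx0).
  by rewrite ?mul_row_col ?mul_col_mx ?(mul0mx, mul1mx, addr0, add0r, add_col_mx).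
Qed.

(* The Schur complement of [Im (mact v (block_mx z 0 0 y))] is therefore [Im y]. *)
Lemma mact_unipotent (v : 'M[rat]_(n + n)) (z : 'M[CC]_q) (y : 'M[CC]_m) :
  par v -> UU v = 1%:M -> SS v = 1%:M -> VV v = 1%:M ->
  exists (b1 : 'M[RR]_(m, q)) (a2 : 'M[RR]_(q, m)) z12 z21 z22,
  [/\ mact v (block_mx z 0 0 y) = block_mx z z12 z21 z22,
      Im_mx z12 = - (Im_mx z *m a2), Im_mx z21 = b1 *m Im_mx z
    & Im_mx z22 = Im_mx y - b1 *m Im_mx z *m a2].
Proof.
move=> pv hU hS hV; have [b1 [b2 [a1 [a2 [k ev]]]]] := unipotent_block pv hU hS hV.
have ImD p r (A B : 'M[CC]_(p, r)) : Im_mx (A + B) = Im_mx A + Im_mx B.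
  by apply/matrixP=> i j; rewrite !mxE raddfD.
have ImN p r (A : 'M[CC]_(p, r)) : Im_mx (- A) = - Im_mx A.
  by apply/matrixP=> i j; rewrite !mxE raddfN.
have ImC p r (A : 'M[rat]_(p, r)) : Im_mx (cmx A) = 0.
  by apply/matrixP=> i j; rewrite cmx_rc !mxE.
have ImCM p r t (A : 'M[rat]_(p, r)) (B : 'M[CC]_(r, t)) :
    Im_mx (cmx A *m B) = map_mx ratr A *m Im_mx B.
  rewrite cmx_rc; apply/matrixP=> i j; rewrite !mxE raddf_sum; apply: eq_bigr => l _.
  by rewrite !mxE; case: (B l j) => x x' /=; rewrite mul0r addr0.
have ImMC p r t (A : 'M[CC]_(p, r)) (B : 'M[rat]_(r, t)) :
    Im_mx (A *m cmx B) = Im_mx A *m map_mx ratr B.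
  rewrite cmx_rc; apply/matrixP=> i j; rewrite !mxE raddf_sum; apply: eq_bigr => l _.
  by rewrite !mxE; case: (A i l) => x x' /=; rewrite mulr0 add0r.
exists (map_mx ratr b1), (map_mx ratr a2), (cmx a1 - z *m cmx a2),
  (cmx b1 *m z + cmx b2), (y + cmx k - (cmx b1 *m z + cmx b2) *m cmx a2).
split.
- apply: (@mactP _ _ _ _ (block_mx 1%:M (cmx a2) 0 1%:M)).
    by rewrite unitmxE det_ublock !det1 mulr1 unitr1.
  rewrite frameM cmx_frame ev block_mxKul block_mxKur block_mxKdl block_mxKdr.
  rewrite /cmx !map_block_mx !map_mx0 !map_mx1.
  rewrite -/(cmx b1) -/(cmx b2) -/(cmx a1) -/(cmx a2) -/(cmx k).
  rewrite !mulmx_block !(mul0mx, mulmx0, mul1mx, mulmx1, addr0, add0r) !add_block_mx.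
  by rewrite !(addr0, add0r) [z *m _ + _]addrC [_ *m cmx a2 + _]addrC !subrK.
- by rewrite ImD ImN ImC add0r ImMC.
- by rewrite ImD ImC addr0 ImCM.
- by rewrite !ImD ImN ImC addr0 ImMC ImD ImC addr0 ImCM.
Qed.

End Unipotent.

Lemma blk11_block q m (A : 'M[CC]_q) B C (D : 'M[CC]_m) :
  blk11 q (block_mx A B C D) = A.
Proof.
apply/matrixP=> i j; rewrite mxE.
by rewrite (entE _ (lshift m i) (lshift m j)) block_mxEul.
Qed.

Lemma posdef_schurY q m (Z : 'M[CC]_(q + m)) (Y11 : 'M[RR]_q) Y12 Y21 (Y22 : 'M[RR]_m) c :
  Im_mx Z = block_mx Y11 Y12 Y21 Y22 ->
  posdef (Y22 - Y21 *m invmx Y11 *m Y12 - c%:M) -> posdef (schurY q Z - c%:M).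
Proof.
move=> eY h; rewrite /schurY eY; move: (addKn q m).
(* [schurY] has size [q + m - q]; generalising this number lets it be replaced by [m]. *)
move: ((q + m) - q)%N => p ep; subst p.
have e11 : \matrix_(i < q, j < q) ent (block_mx Y11 Y12 Y21 Y22) i j = Y11.
  by apply/matrixP=> i j; rewrite mxE (entE _ (lshift m i) (lshift m j)) block_mxEul.
have e12 : \matrix_(i < q, j < m) ent (block_mx Y11 Y12 Y21 Y22) i (q + j) = Y12.
  by apply/matrixP=> i j; rewrite mxE (entE _ (lshift m i) (rshift q j)) block_mxEur.
have e21 : \matrix_(i < m, j < q) ent (block_mx Y11 Y12 Y21 Y22) (q + i) j = Y21.
  by apply/matrixP=> i j; rewrite mxE (entE _ (rshift q i) (lshift m j)) block_mxEdl.
have e22 : \matrix_(i < m, j < m) ent (block_mx Y11 Y12 Y21 Y22) (q + i) (q + j) = Y22.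
  by apply/matrixP=> i j; rewrite mxE (entE _ (rshift q i) (rshift q j)) block_mxEdr.
by rewrite /= e11 e12 e21 e22.
Qed.

Lemma SpQM n (A B : 'M[rat]_(n + n)) : SpQ A -> SpQ B -> SpQ (A *m B).
Proof.
move=> /SpQ_sim hA /SpQ_sim hB; apply/SpQ_sim.
by rewrite -[1]mulr1; apply: simM.
Qed.

Lemma Im_ci_rc p r (A : 'M[RR]_(p, r)) : Im_mx (ci *: rc A) = A.
Proof. by apply/matrixP=> i j; rewrite !mxE /= mul0r mul1r add0r. Qed.

Section Levi.
Variables q m : nat.
Local Notation n := (q + m)%N.

Lemma frame_block (z : 'M[CC]_q) (y : 'M[CC]_m) : frame (block_mx z 0 0 y) =
  row_mx (cmx (iS q m) *m frame z) (cmx (iU q m) *m y + cmx (iV q m)).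
Proof.
rewrite /frame /iS /iU /iV /cmx map_block_mx !map_col_mx !map_mx0 !map_mx1.
rewrite mul_block_col !mul_col_mx !(mul0mx, mul1mx, mulmx1, addr0, add0r) add_col_mx.
rewrite !(addr0, add0r) (scalar_mx_block q m) !block_mxEh.
by rewrite -[LHS]/(block_mx _ _ _ _) block_mxEh.
Qed.

(** The Levi element sends the frame to its conjugate times [diag(K, t)]; on the columns
    [iU (i Y) + iV] this is the relation [s Y = - Y t]. *)
Lemma levi_fixed_point (s : 'M[rat]_m) (S : 'M[rat]_(q + q)) (t : 'M[rat]_m)
    (z K : 'M[CC]_q) (Y : 'M[RR]_m) :
  sim (- 1) (levi s S t) -> hn (block_mx z 0 0 (ci *: rc Y)) ->
  cmx S *m frame z = cj (frame z) *m K -> map_mx ratr s *m Y = - (Y *m map_mx ratr t) ->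
  mact (Emq n *m levi s S t) (block_mx z 0 0 (ci *: rc Y))
    = tauZ (block_mx z 0 0 (ci *: rc Y)).
Proof.
set l := levi s S t; set Z0 := block_mx _ _ _ _ => hl hZ eK eY.
have hEl : SpQ (Emq n *m l).
  by apply/SpQ_sim; rewrite (_ : 1 = - 1 * - 1) //; apply: simM => //; exact: Emq_sim.
have cci : cj (ci *: rc Y) = - (ci *: rc Y).
  apply/matrixP=> i j; rewrite !mxE.
  by apply/eqP; rewrite eq_complex /=; apply/andP; split; apply/eqP; ring.
have e : cmx l *m frame Z0 = cj (frame Z0) *m block_mx K 0 0 (cmx t).
  rewrite cj_frame {2}/Z0 map_block_mx !map_mx0 cci /Z0 !frame_block.
  rewrite mul_mx_row mul_row_block !mulmx0 addr0 add0r mulmxDr !mulmxA -!cmxM.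
  rewrite levi_iS levi_iU levi_iV; congr row_mx.
    by rewrite cmxM -mulmxA eK mulmxA cj_frame.
  rewrite mulmxDl !cmxM mulmxN mulNmx -!mulmxA; congr (_ + _).
  rewrite -mulmxN; congr (_ *m _); rewrite -scalemxAr -scalemxAl -scalerN; congr (_ *: _).
  by rewrite !cmx_rc -!map_mxM eY map_mxN.
have [_ [L uL eL]] := SpQ_frame hEl hZ.
have e2 : frame (mact (Emq n *m l) Z0) *m L = frame (tauZ Z0) *m - block_mx K 0 0 (cmx t).
  by rewrite -eL cmxM -mulmxA e frame_tauZ mulNmx mulmxN opprK mulmxA.
apply: (@mactP _ _ _ _ L) => //; rewrite eL e2; congr (_ *m _).
by move: e2; rewrite !frameM => /eq_col_mx[_ ->].
Qed.

Lemma satake_fixed_point (g gam : 'M[rat]_(n + n)) (z K : 'M[CC]_q) (eps c : RR) :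
  SpQ g -> SpQ gam -> hn z -> refl_of g gam *m refl_of g gam = 1%:M ->
  par (refl_of g gam) -> cmx (SS (refl_of g gam)) *m frame z = cj (frame z) *m K ->
  0 < eps -> 0 < c -> exists Z', hn_fix gam Z' /\ satake_nbhd g z eps c Z'.
Proof.
move=> hg hgam hz; have := refl_sim hg hgam.
have [sg esg] : exists sg, sg = refl_of g gam by eexists.
rewrite -esg => hsg sgsg psg eK eps0 c0.
have [s es] : exists s, s = UU sg by eexists.
have [S eS] : exists S, S = SS sg by eexists.
have [t et] : exists t, t = VV sg by eexists.
have ss : s *m s = 1%:M by rewrite es -UU_M // sgsg UU1.
have SS_ : S *m S = 1%:M by rewrite eS -SS_M // sgsg SS1.
have tt_ : t *m t = 1%:M by rewrite et -VV_M // sgsg VV1.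
have st : s^T *m t = (- 1)%:M by rewrite es et; apply: sim_UU_VV.
have ets : t = - s^T.
  by rewrite -[t]mul1mx -trmx1 -ss trmx_mul -mulmxA st raddfN /= mulmxN mulmx1.
have [l el] : exists l, l = @levi q m s S t by eexists.
have pl : par l by rewrite el; exact: levi_par.
have hl : sim (- 1) l.
  by rewrite el; apply: levi_sim => //; rewrite eS; apply: sim_SS.
have ll : l *m l = 1%:M by rewrite el leviM ss SS_ tt_ levi1.
have adjE A : sim (- 1) A -> A *m A = 1%:M -> adj A = - A.
  by move=> /sim_adj h AA; rewrite -[LHS]mulmx1 -AA mulmxA h raddfN /= mulNmx mul1mx.
have asg := adjE _ _ hsg sgsg; have al := adjE _ _ hl ll.
have [N eN] : exists N, N = sg *m l - 1%:M by eexists.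
have e1N : 1%:M + N = sg *m l by rewrite eN addrC subrK.
have pN : par N by rewrite eN; apply: parD; [exact: parM | apply: parN; exact: par1].
have NU : UU N = 0.
  by rewrite eN -scaleN1r UU_D UU_Z UU1 UU_M // el levi_UU -es ss scaleN1r subrr.
have NS : SS N = 0.
  by rewrite eN -scaleN1r SS_D SS_Z SS1 SS_M // el levi_SS -eS SS_ scaleN1r subrr.
have NV : VV N = 0.
  by rewrite eN -scaleN1r VV_D VV_Z VV1 VV_M // el levi_VV -et tt_ scaleN1r subrr.
have N3 := par_nilpotent pN NU NS NV.
have eaN : adj N = l *m sg - 1%:M.
  by rewrite eN adjD adjN adj1 adjM asg al mulNmx mulmxN opprK.
have NN' : (1%:M + N) *m (1%:M + adj N) = 1%:M.
  by rewrite e1N eaN addrC subrK mulmxA -(mulmxA sg) ll mulmx1.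
(* [v] is the square root of the unipotent [sg l], which [l] conjugates to its inverse [l sg]. Hence
   [l v l = v^-1], and [sg v = (sg l) (l v) = v l]: [v] conjugates the Levi part [l] to [sg]. *)
have [v ev] : exists v, v = usqrt N by eexists.
have pv : par v by rewrite ev; exact: par_usqrt.
have hv : SpQ v.
  apply/SpQ_sim/sim_adj; rewrite ev adj_usqrt; apply: mulmx1C.
  exact: usqrt_inv N3 NN'.
have sgv : sg *m v = v *m l.
  have lv : l *m v = usqrt (adj N) *m l.
    have := usqrt_conj N ll; rewrite -ev => h.
    have <- : l *m N *m l = adj N.
      by rewrite eaN eN mulmxBr mulmxBl mulmx1 ll mulmxA -mulmxA ll mulmx1.
    by rewrite -h -mulmxA ll mulmx1.
  have -> : sg *m v = sg *m l *m (l *m v) by rewrite mulmxA -(mulmxA sg) ll mulmx1.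
  rewrite -e1N lv -(usqrt_sqr N3) mulmxA -(mulmxA (usqrt N)) (usqrt_inv N3 NN') mulmx1.
  by rewrite ev.
have [R eR] : exists R : 'M[RR]_m, R = map_mx ratr s by eexists.
have RR1 : R *m R = 1%:M by rewrite eR -map_mxM ss map_mx1.
(* As [R^2 = 1], [R Y = Y R^T], which is the relation wanted because [t = - s^T]; the factor [c + 1]
   keeps [Y - c] positive definite. *)
pose Y : 'M[RR]_m := (c + 1)%:M + (c + 1) *: (R *m R^T).
have c1 : 0 < c + 1 by rewrite addr_gt0.
have pY : posdef Y by apply: posdef_scalar_gram => //; exact: ltW.
have Ys : Y^T = Y.
  by rewrite /Y linearD /= tr_scalar_mx linearZ /= trmx_mul trmxK.
have ImY := Im_ci_rc Y.
have hZ0 : hn (block_mx z 0 0 (ci *: rc Y)).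
  have [zs zp] := hz; split.
    by rewrite tr_block_mx !trmx0 zs linearZ /= map_trmx Ys.
  rewrite /Im_mx map_block_mx -!/(Im_mx _) ImY.
  have Im0 p r : Im_mx (0 : 'M[CC]_(p, r)) = 0 by apply/matrixP=> i j; rewrite !mxE.
  by rewrite !Im0; exact: posdef_block_diag.
have lZ0 : mact (Emq n *m l) (block_mx z 0 0 (ci *: rc Y))
    = tauZ (block_mx z 0 0 (ci *: rc Y)).
  rewrite el; apply: (@levi_fixed_point _ _ _ _ K) => //; rewrite -?el ?eS //.
  rewrite ets map_mxN mulmxN opprK -map_trmx -eR /Y mulmxDr mulmxDl mul_mx_scalar.
  rewrite mul_scalar_mx -scalemxAr -scalemxAl mulmxA RR1 mul1mx -mulmxA -trmx_mul RR1.
  by rewrite trmx1 mulmx1 addrC.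
have hEl : SpQ (Emq n *m l).
  by apply/SpQ_sim; rewrite (_ : 1 = - 1 * - 1) //; apply: simM => //; exact: Emq_sim.
move: lZ0 hZ0; set Z0 := block_mx _ _ _ _ => lZ0 hZ0.
have [hZ _] := SpQ_frame hv hZ0.
have [hZ' _] := SpQ_frame hg hZ.
exists (mact g (mact v Z0)); split.
  split=> //; rewrite -(mactM hgam hg hZ) -(mactM (SpQM hgam hg) hv hZ0).
  have hgv : SpQ (g *m v) by exact: SpQM.
  have ug : g \in unitmx by apply: (@sim_unitmx _ 1) => //; apply/SpQ_sim.
  (* [gam g v = E g sg v = E g v l]; here [E l] sends [Z0] to [tau Z0], and [E (g v) E] is
     [tau (g v)]. *)
  have -> : gam *m g *m v = Emq n *m (g *m v) *m Emq n *m (Emq n *m l).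
    rewrite -!mulmxA (mulmxA (Emq n) (Emq n)) EmqK mul1mx -sgv esg /refl_of.
    by rewrite !mulmxA mulmxK // EmqK mul1mx.
  have hE : SpQ (Emq n *m (g *m v) *m Emq n).
    apply/SpQ_sim; rewrite (_ : 1 = - 1 * 1 * - 1) //.
    by apply: simM; [apply: simM; [exact: Emq_sim | exact/SpQ_sim] | exact: Emq_sim].
  by rewrite (mactM hE hEl hZ0) lZ0 (mact_tau hgv hZ0) (mactM hg hv hZ0).
exists 1%:M, (mact v Z0).
have hgu : g \in unitmx by apply: (@sim_unitmx _ 1) => //; apply/SpQ_sim.
have vU : UU v = 1%:M by rewrite ev UU_usqrt.
have vS : SS v = 1%:M by rewrite ev SS_usqrt.
have vV : VV v = 1%:M by rewrite ev VV_usqrt.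
have [b1 [a2 [z12 [z21 [z22 [eZ i12 i21 i22]]]]]] := mact_unipotent z (ci *: rc Y) pv vU vS vV.
split; first by apply/SpQ_sim; exact: sim1.
split.
  rewrite mulmx1 mulmxV //; split; last exact: integral_mx1.
  by apply/SpQ_sim; exact: sim1.
split.
  move=> w _ u; split=> [[w' [hw' ->]]|hu]; first by rewrite cmx1 mul1mx.
  by exists u; rewrite cmx1 mul1mx.
split; [exact: hZ | split].
  by rewrite /Z0 eZ blk11_block => i j; rewrite subrr /= !normr0.
split; last by rewrite mulmx1.
apply: (@posdef_schurY _ _ _ (Im_mx z) (Im_mx z12) (Im_mx z21) (Im_mx z22)).
  by rewrite /Z0 eZ /Im_mx map_block_mx.
rewrite i12 i21 i22 ImY.
have uY := posdef_unitmx (proj2 hz).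
have -> : Y - b1 *m Im_mx z *m a2 - b1 *m Im_mx z *m invmx (Im_mx z) *m - (Im_mx z *m a2) = Y.
  by rewrite mulmxN opprK mulmxK // mulmxA subrK.
have -> : Y - c%:M = 1%:M + (c + 1) *: (R *m R^T).
  by rewrite /Y addrAC -raddfB /= [c + 1 - c]addrAC subrr add0r.
by apply: posdef_scalar_gram => //; exact: ltW.
Qed.

End Levi.

(** * Lifting to an involution in the congruence subgroup *)

Section FixedSets.
Variables q m : nat.
Local Notation n := (q + m)%N.

Lemma par_inv e (A : 'M[rat]_(n + n)) : e != 0 -> sim e A -> par A -> par (invmx A).
Proof.
move=> e0 hA pA; have uA := sim_unitmx e0 hA.
have us : UU A \in unitmx.
  have := sim_UU_VV hA pA; move/(congr1 ( *:%R e^-1)).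
  rewrite scalemxAr scale_scalar_mx mulVf // => /mulmx1_unit[].
  by rewrite unitmx_tr.
apply: (@sim_par _ _ e^-1 _ (invmx (UU A))); first by rewrite invr_eq0.
  exact: sim_inv.
apply: (canLR (mulKmx uA)); rewrite mulmxA (par_iU pA).
by move: (UU A) us => u us; rewrite mulmxK.
Qed.

(** The converse inclusion is the forward one for [sg^-1], whose [S] block is again [SS sg]. The
    criterion sees [sg] only through this block. *)
Lemma fixed_iff (sg : 'M[rat]_(n + n)) (z : 'M[CC]_q) :
  sim (- 1) sg -> par sg -> SS sg *m SS sg = 1%:M -> hn z ->
  (forall w, @Wq n q z w <-> @Wq n q z (cj (cmx sg *m w))) <->
  exists K, cmx (SS sg) *m frame z = cj (frame z) *m K.
Proof.
move=> hs ps SSs hz; split=> [h|[K eK] w].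
  by case: (fixed_par hs hz (fun w => (h w).1)).
split; first exact: fixed_fwd eK w.
have us : sg \in unitmx by apply: sim_unitmx hs.
have pi : par (invmx sg) by apply: par_inv hs ps.
have eSi : SS (invmx sg) = SS sg.
  have : SS (invmx sg) *m SS sg = 1%:M by rewrite -SS_M // mulVmx // SS1.
  by move=> h; rewrite -[LHS]mulmx1 -SSs mulmxA h mul1mx.
rewrite -eSi in eK; move/(fixed_fwd pi eK).
by rewrite -{1}[cmx (invmx sg)]cj_cmx -cjM cjK mulmxA -cmxM mulVmx // cmx1 mul1mx.
Qed.

End FixedSets.

(** Stated for an arbitrary presentation of the point, as [satake_closure] quantifies over all of
    them; that [E gam] is an involution is independent of the presentation. *)
Lemma satake_closure_fixed n q (g gam : 'M[rat]_(n + n)) (z : 'M[CC]_q) (x : pt n)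
    (eps c : RR) :
  (q < n)%N -> SpQ g -> SpQ gam -> (Emq n *m gam) *m (Emq n *m gam) = 1%:M -> hn z ->
  pt_eq x (gact g (@Wq n q z)) -> pt_eq (tau_pt x) (gact gam x) -> 0 < eps -> 0 < c ->
  exists Z', hn_fix gam Z' /\ satake_nbhd g z eps c Z'.
Proof.
move=> qn; have [m en] : exists m, n = (q + m)%N by exists (n - q)%N; rewrite subnKC // ltnW.
subst n => hg hgam EE hz xW fx eps0 c0.
have ug : g \in unitmx by apply: (@sim_unitmx _ 1) => //; apply/SpQ_sim.
have hs := refl_sim hg hgam.
have [ps [K eK]] := fixed_par hs hz (fun w => ((fix_iff hg hgam xW).1 fx w).1).
apply: (satake_fixed_point hg hgam hz _ ps eK) => //.
rewrite /refl_of; move: (Emq _ *m gam) EE => s ss.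
by rewrite !mulmxA mulmxK // -(mulmxA _ s s) ss mulmx1 mulVmx.
Qed.

Section InvolutionInGamma.
Variables (k q m : nat).
Local Notation n := (q + m)%N.
Variables (g gam : 'M[rat]_(n + n)).
Hypotheses (hg : SpQ g) (hgam : SpQ gam) (gam1 : congr_mx (2 ^ k.+1) gam 1%:M).

(** Conjugation by a rational [g] does not respect congruences. With [g = g0 h], the lift is made
    for [s0 = h sg h^-1], which is integral, and [h] is parabolic, so [S] blocks are merely
    conjugated. *)
Lemma fixed_involution (z : 'M[CC]_q) :
  hn z -> (forall w, @Wq n q z w <-> @Wq n q z (cj (cmx (refl_of g gam) *m w))) ->
  exists gam' : 'M[rat]_(n + n),
  [/\ SpQ gam', congr_mx (2 ^ k.+1) gam' 1%:M, (Emq n *m gam') *m (Emq n *m gam') = 1%:M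
    & [/\ par (refl_of g gam), par (refl_of g gam'),
          SS (refl_of g gam') = SS (refl_of g gam)
        & SS (refl_of g gam) *m SS (refl_of g gam) = 1%:M]].
Proof.
move=> hz fx; have hs := refl_sim hg hgam.
have [sg esg] : exists sg, sg = refl_of g gam by eexists.
rewrite -esg in fx hs *.
have [ps [K eK]] := fixed_par hs hz (fun w => (fx w).1).
have [g0 [h [[hg0 ig0] hh ph eg]]] := SpQ_iwasawa hg.
have unit1 A : @SpQ n A -> A \in unitmx.
  by move=> /SpQ_sim; apply: sim_unitmx.
have ug0 := unit1 _ hg0; have uh := unit1 _ hh.
have ig0' : integral_mx (invmx g0) by rewrite SpQ_invmx //; exact: integral_adj.
have phi : par (invmx h) by apply: (@par_inv _ _ 1) => //; apply/SpQ_sim.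
have eref A : refl_of g A = invmx h *m refl_of g0 A *m h.
  rewrite /refl_of; have -> : invmx g = invmx h *m invmx g0.
    have e : invmx h *m invmx g0 *m g = 1%:M by rewrite eg mulmxA mulmxKV // mulVmx.
    by rewrite -[LHS]mul1mx -e mulmxK // unit1.
  by rewrite eg !mulmxA.
have [s0 es0] : exists s0, s0 = refl_of g0 gam by eexists.
have es0' : s0 = h *m sg *m invmx h.
  by rewrite esg eref -es0 !mulmxA mulmxV // mul1mx mulmxK.
have hs0 : sim (- 1) s0 by rewrite es0; exact: refl_sim.
have ps0 : par s0 by rewrite es0'; apply: parM => //; apply: parM.
(* Since [E = 1 - 2 diag(0, 1)], the matrix [s0] is congruent to [1 - 2 P] with [P] an integral
   idempotent. *)
have [P eP] : exists P, P = invmx g0 *m block_mx 0 0 0 1%:M *m g0 by eexists.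
have iP : integral_mx P.
  rewrite eP; apply: integral_mxM => //; apply: integral_mxM => //.
  by apply: integral_block_mx; try exact: integral_mx0; exact: integral_mx1.
have PP : P *m P = P.
  rewrite eP !mulmxA mulmxK // -(mulmxA (invmx g0)) mulmx_block.
  by rewrite !(mulmx0, mul0mx, mulmx1, addr0, add0r).
have EP : invmx g0 *m Emq n *m g0 = 1%:M - 2 *: P.
  have -> : Emq n = 1%:M - 2 *: block_mx 0 0 0 1%:M.
    rewrite scale_block_mx !scaler0 (scalar_mx_block n n) opp_block_mx add_block_mx.
    rewrite !oppr0 !addr0 /Emq; congr block_mx.
    by rewrite scaler_nat mulr2n opprD addNKr.
  by rewrite mulmxBr mulmx1 mulmxBl mulVmx // -scalemxAr -scalemxAl -eP.
have s0P : congr_mx (2 ^ k.+1) s0 (1%:M - 2 *: P).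
  rewrite -EP es0; apply: congr_mxMr => //; apply: congr_mxMl => //.
  rewrite -[X in congr_mx _ _ X]mulmx1; apply: congr_mxMl => //.
  apply: integral_block_mx; try exact: integral_mx0; first exact: integral_mx1.
  by apply: integral_mxN; exact: integral_mx1.
have hS := sim_SS hs ps.
have [Q [Qs Qp QS]] := siegel_form hS hz eK.
have SSh : SS h *m SS (invmx h) = 1%:M by rewrite -SS_M // mulmxV // SS1.
have SSh' := mulmx1C SSh.
have eSS0 : SS s0 = SS h *m SS sg *m SS (invmx h).
  by rewrite es0' !SS_M //; apply: parM.
have SS02 : SS s0 *m SS s0 = 1%:M.
  have iS0 : integral_mx (SS ((1 / 2) *: (1%:M - s0))).
    apply: integral_mxM; last exact: integral_iS.
    apply: integral_mxM; first by apply: integral_mx_tr; exact: integral_iS.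
    exact: congr_mx_integral (congr_half s0P) iP.
  (* The invariant form of [SS sg] is transported to [SS s0], whose integrality is known. *)
  pose B : 'M[RR]_(q + q) := map_mx ratr (SS h).
  have BB : B *m map_mx ratr (SS (invmx h)) = 1%:M by rewrite -map_mxM SSh map_mx1.
  have uB : B \in unitmx by case/mulmx1_unit: BB.
  apply: (@isometry_involution _ _ _ (B *m Q *m B^T) iS0).
  - rewrite SS_Z SS_D SS1 -[- s0]scaleN1r SS_Z scaleN1r scalerA (_ : 2 * (1 / 2) = 1) //.
    by rewrite scale1r opprB addrC subrK.
  - by rewrite !trmx_mul trmxK Qs mulmxA.
  - exact: posdef_congr.
  - have eB : map_mx ratr (SS s0) *m B = B *m map_mx ratr (SS sg).
      by rewrite /B -!map_mxM eSS0 -mulmxA SSh' mulmx1.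
    have -> : map_mx ratr (SS s0) *m (B *m Q *m B^T) *m (map_mx ratr (SS s0))^T
        = (map_mx ratr (SS s0) *m B) *m Q *m (map_mx ratr (SS s0) *m B)^T.
      by rewrite trmx_mul !mulmxA.
    by rewrite eB trmx_mul -{2}QS !mulmxA.
have SSg2 : SS sg *m SS sg = 1%:M.
  have e : SS sg = SS (invmx h) *m SS s0 *m SS h.
    by rewrite esg eref -es0 !SS_M //; apply: parM.
  rewrite e; move: (SS (invmx h)) (SS s0) (SS h) SSh SSh' SS02 => X Y W XW WX YY.
  by rewrite -!mulmxA (mulmxA W) XW mul1mx (mulmxA Y) YY mul1mx WX.
have [s1 [hs1 ps1 eSS1 s1s1 s1s0]] := involution_lift hs0 ps0 SS02 iP PP s0P.
have [gam' egam'] : exists gam', gam' = Emq n *m (g0 *m s1 *m invmx g0) by eexists.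
have Eg' : Emq n *m gam' = g0 *m s1 *m invmx g0 by rewrite egam' mulmxA EmqK mul1mx.
have ref' : refl_of g0 gam' = s1.
  by rewrite /refl_of Eg' !mulmxA mulVmx // mul1mx mulmxKV.
exists gam'; split.
- apply/SpQ_sim; rewrite egam' (_ : 1 = - 1 * (1 * - 1 * 1^-1)) //.
  apply: simM; first exact: Emq_sim.
  apply: simM; last by apply: sim_inv => //; exact/SpQ_sim.
  by apply: simM => //; exact/SpQ_sim.
- apply: (congr_mx_trans _ gam1).
  have -> : gam = Emq n *m (g0 *m s0 *m invmx g0).
    by rewrite es0 /refl_of !mulmxA !mulmxK // EmqK mul1mx.
  rewrite egam'; apply: congr_mxMl.
    apply: integral_block_mx; try exact: integral_mx0; first exact: integral_mx1.
    by apply: integral_mxN; exact: integral_mx1.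
  by apply: congr_mxMr => //; apply: congr_mxMl.
- by rewrite Eg' !mulmxA mulmxKV // -(mulmxA _ s1 s1) s1s1 mulmx1 mulmxV.
- split=> //.
  + by rewrite eref ref'; apply: parM => //; apply: parM.
  + by rewrite esg !eref ref' -es0 !SS_M // ?eSS1 //; apply: parM.
Qed.

End InvolutionInGamma.

Theorem theorem10p5 (k n q : nat) (g gam : 'M[rat]_(n + n)) :
  (2 <= k)%nat -> (q < n)%nat -> SpQ g -> GammaN (2 ^ k) gam ->
  (exists x, bcomp_fix q g gam x) ->
  exists gam1 : 'M[rat]_(n + n),
    GammaN (2 ^ k) gam1 /\
    (forall x, bcomp_fix q g gam x <-> bcomp_fix q g gam1 x) /\
    (forall x, bcomp_fix q g gam1 x -> satake_closure (hn_fix gam1) x).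
Proof.
(* The exponent is written as a successor because halving [1 - sg] leaves the modulus [2 ^ k]. *)
case: k => // k _ qn.
have [m en] : exists m, n = (q + m)%N by exists (n - q)%N; rewrite subnKC // ltnW.
subst n => hg [[hgam _] cgam] [x0 [[z0 [hz0 x0W]] fx0]].
have N0 : (0 < 2 ^ k.+1)%N by rewrite expn_gt0.
have gam1 : congr_mx (2 ^ k.+1) gam 1%:M.
  by apply/congr_mxP => // i j; rewrite [1%:M i j]mxE; exact: cgam.
have [gam' [hgam' c' EE [ps ps' eSS SS2]]] :=
  fixed_involution hg hgam gam1 hz0 ((fix_iff hg hgam x0W).1 fx0).
exists gam'; split; last split.
- split; first by split=> //; apply: congr_mx_integral c' _; exact: integral_mx1.
  by move=> i j; have /congr_mxP/(_ i j) := c'; rewrite [1%:M i j]mxE; apply.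
- have SS2' : SS (refl_of g gam') *m SS (refl_of g gam') = 1%:M by rewrite eSS.
  (* Both fixed sets are cut out by the same condition on [z], as the two [S] blocks agree. *)
  have F z (hz : hn z) := fixed_iff (refl_sim hg hgam) ps SS2 hz.
  have F' z (hz : hn z) := fixed_iff (refl_sim hg hgam') ps' SS2' hz.
  move=> x; split=> -[[z [hz xW]] fx]; (split; first exact: (ex_intro _ z (conj hz xW))).
    apply: (fix_iff hg hgam' xW).2; apply: (F' z hz).2; rewrite eSS; apply: (F z hz).1.
    exact: (fix_iff hg hgam xW).1 fx.
  apply: (fix_iff hg hgam xW).2; apply: (F z hz).2; rewrite -eSS; apply: (F' z hz).1.
  exact: (fix_iff hg hgam' xW).1 fx.
- move=> x [[z [hz xW]] fx]; right; split.
    by exists q, g; split; [exact: qn | split; [exact: hg | exact: (ex_intro _ z (conj hz xW))]].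
  (* The presentation [(q1, g1, z1)] of [x] may differ from [(q, g, z)]. *)
  move=> q1 g1 z1 q1n hg1 hz1 xW1 eps c eps0 c0.
  exact: (satake_closure_fixed q1n hg1 hgam' EE hz1 xW1 fx).
Qed.
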